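(* Suppose that the field $\Bbbk$ has characteristic zero and that $\mathscr{C}$ is locally self-injective. Then the Nakayama functor $\nu:\mathscr{C}\text{-mod}\to\mathscr{C}\text{-fdmod}$ induces an equivalence of categories $$\overline{\nu}:\ \mathscr{C}\text{-mod}/\operatorname{Ker}(\nu)\ \xrightarrow{\ \sim\ }\ \mathscr{C}\text{-fdmod}.$$
   Context: Let $\Bbbk$ be a field. An EI-category is a small category in which every endomorphism is an isomorphism. $\mathscr{C}$ is a skeletal EI-category with object set $I$; $\mathscr{C}(i,j)$ is the set of morphisms from $i$ to $j$. A left (resp. right) $\mathscr{C}$-module is a covariant (resp. contravariant) functor from $\mathscr{C}$ to $\Bbbk$-vector spaces. Let $A=\bigoplus_{i,j\in I}\Bbbk\mathscr{C}(i,j)$ be the (possibly non-unital) category algebra, with multiplication given by composition of morphisms (zero when not composable), and let $e_i\in\mathscr{C}(i,i)$ be the identity of $i$. A left (resp. right) $A$-module $V$ is graded if $V=\bigoplus_{i}e_iV$ (resp. $V=\bigoplus_i Ve_i$). Left (right) $\mathscr{C}$-modules $W$ are identified with graded left (right) $A$-modules via $W\mapsto\bigoplus_i W(i)$; thus $Ae_i$ is the left $\mathscr{C}$-module $j\mapsto\Bbbk\mathscr{C}(i,j)$ and $e_iA$ is the right $\mathscr{C}$-module $j\mapsto\Bbbk\mathscr{C}(j,i)$. A module is finitely generated (resp. finite-dimensional) if it is so as a graded $A$-module. $\mathscr{C}\text{-mod}$ (resp. $\mathscr{C}^{\mathrm{op}}\text{-mod}$) is the category of finitely generated left (resp. right)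 $\mathscr{C}$-modules, and $\mathscr{C}\text{-fdmod}$ (resp. $\mathscr{C}^{\mathrm{op}}\text{-fdmod}$) is its full subcategory of finite-dimensional modules. Standing assumptions: $\mathscr{C}$ is inwards finite (for each $j\in I$ there are only finitely many $i\in I$ with $\mathscr{C}(i,j)\neq\emptyset$), hom-finite (each $\mathscr{C}(i,j)$ is finite), and locally noetherian (every submodule of a finitely generated left $\mathscr{C}$-module is finitely generated). For $V$ in $\mathscr{C}\text{-mod}$, $\operatorname{Hom}_{\mathscr{C}}(V,A)\cong\bigoplus_{i\in I}\operatorname{Hom}_{\mathscr{C}}(V,Ae_i)$ is a finite-dimensional right $\mathscr{C}$-module (via right multiplication on $A$). Let $D=\operatorname{Hom}_{\Bbbk}(-,\Bbbk)$ be the standard duality between finite-dimensional left and finite-dimensional right $\mathscr{C}$-modules. The Nakayama functor is $\nu=D\circ\operatorname{Hom}_{\mathscr{C}}(-,A):\mathscr{C}\text{-mod}\to\mathscr{C}\text{-fdmod}$. $\mathscr{C}$ is locally self-injective if $Ae_i$ is an injective left $\mathscr{C}$-module for every $i\in I$. $\operatorname{Ker}(\nu)$ is the full subcategory of $\mathscr{C}\text{-mod}$ on the objects $V$ with $\nu(V)=0$. If $\mathscr{C}$ is locally self-injective then $\nu$ is exact, so $\operatorname{Ker}(\nu)$ is a Serre subcategory (closed under submodules, quotients and extensions), and $\mathscr{C}\text{-mod}/\operatorname{Ker}(\nu)$ denotes the Serre quotient category. *)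

(* Defs.v *)
From HB Require Import structures.
From mathcomp Require Import all_boot all_order all_algebra.
From mathcomp Require Import boolp classical_sets cardinality.

Set Implicit Arguments.
Unset Strict Implicit.
Unset Printing Implicit Defensive.

Import GRing.Theory.
Local Open Scope ring_scope.

(* [comp g f] is "g after f". *)
Record category := Category {
  ob :> Type;
  hom : ob -> ob -> Type;
  idm : forall x, hom x x;
  comp : forall x y z, hom y z -> hom x y -> hom x z;
  comp_idl : forall x y (f : hom x y), comp (idm y) f = f;
  comp_idr : forall x y (f : hom x y), comp f (idm x) = f;
  comp_assoc : forall x y z t (h : hom z t) (g : hom y z) (f : hom x y),
    comp h (comp g f) = comp (comp h g) f }.

Arguments idm {c} x.
Arguments comp {c x y z} g f.

Definition is_iso (A : category) (x y : A) (f : hom x y) : Prop :=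
  exists g : hom y x, comp g f = idm x /\ comp f g = idm y.

Record functor (A B : category) := Functor {
  fobj :> A -> B;
  fmap : forall x y, hom x y -> hom (fobj x) (fobj y);
  fmap_id : forall x, fmap (idm x) = idm (fobj x);
  fmap_comp : forall x y z (g : hom y z) (f : hom x y),
    fmap (comp g f) = comp (fmap g) (fmap f) }.

Arguments fmap {A B} f {x y} _ : rename.

Program Definition functor_id (A : category) : functor A A :=
  @Functor A A (fun x => x) (fun _ _ f => f) _ _.

Program Definition functor_comp (A B D : category)
    (G : functor B D) (F : functor A B) : functor A D :=
  @Functor A D (fun x => G (F x)) (fun _ _ f => fmap G (fmap F f)) _ _.
Next Obligation. by rewrite !fmap_id. Qed.
Next Obligation. by rewrite !fmap_comp. Qed.

Definition nat_isomorphic (A B : category) (F G : functor A B) : Prop :=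
  exists eta : forall x, hom (F x) (G x),
    (forall x, is_iso (eta x)) /\
    (forall x y (f : hom x y),
       comp (eta y) (fmap F f) = comp (fmap G f) (eta x)).

Definition is_equivalence (A B : category) (F : functor A B) : Prop :=
  exists G : functor B A,
    nat_isomorphic (functor_comp G F) (functor_id A) /\
    nat_isomorphic (functor_comp F G) (functor_id B).

Program Definition full_subcategory (A : category) (P : A -> Prop) :
    category :=
  @Category {x : A | P x} (fun x y => hom (sval x) (sval y))
    (fun x => idm (sval x)) (fun _ _ _ g f => comp g f) _ _ _.
Next Obligation. exact: comp_idl. Qed.
Next Obligation. exact: comp_idr. Qed.
Next Obligation. exact: comp_assoc. Qed.

Record fincat := FinCat {
  fob :> Type;
  fhom : fob -> fob -> finType;
  fid : forall i, fhom i i;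
  fcomp : forall i j l, fhom j l -> fhom i j -> fhom i l;
  fcomp_idl : forall i j (f : fhom i j), fcomp (fid j) f = f;
  fcomp_idr : forall i j (f : fhom i j), fcomp f (fid i) = f;
  fcomp_assoc : forall i j l m (h : fhom l m) (g : fhom j l) (f : fhom i j),
    fcomp h (fcomp g f) = fcomp (fcomp h g) f }.

Arguments fid {f} i : rename.
Arguments fcomp {f i j l} _ _ : rename.

Definition cat_of_fincat (C : fincat) : category :=
  @Category C (fun i j => fhom i j) (@fid C) (@fcomp C)
    (@fcomp_idl C) (@fcomp_idr C) (@fcomp_assoc C).

Coercion cat_of_fincat : fincat >-> category.

Definition EI (C : category) : Prop :=
  forall (i : C) (f : hom i i), is_iso f.

Definition skeletal (C : category) : Prop :=
  forall (i j : C) (f : hom i j), is_iso f -> i = j.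

Definition inwards_finite (C : fincat) : Prop :=
  forall j : C, finite_set [set i : C | inhabited (fhom i j)]%classic.

Definition opcat (C : fincat) : fincat :=
  @FinCat C (fun i j => fhom j i) (@fid C) (fun _ _ _ g f => fcomp f g)
    (fun _ _ f => fcomp_idr f) (fun _ _ f => fcomp_idl f)
    (fun _ _ _ _ h g f => esym (fcomp_assoc f g h)).

Section LinearMaps.
Variable k : fieldType.

Definition mklin (U V : lmodType k) (f : U -> V) (lf : linear f) :
    {linear U -> V} :=
  HB.pack f (@GRing.isLinear.Build k U V *:%R f lf).

Lemma lin_ext (U V : lmodType k) (f g : {linear U -> V}) : f =1 g -> f = g.
Proof.
case: f g => [f cf] [g cg] /= /funext e.
case: cf cg => [[f1] [f2]] [[g1] [g2]].
by subst g; rewrite (Prop_irrelevance f1 g1) (Prop_irrelevance f2 g2).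
Qed.

End LinearMaps.

Section Modules.
Variables (k : fieldType) (C : fincat).

Record cmodule := CModule {
  mob :> C -> lmodType k;
  act : forall i j : C, fhom i j -> {linear mob i -> mob j};
  act_id : forall i x, act (fid i) x = x;
  act_comp : forall i j l (g : fhom j l) (f : fhom i j) x,
    act (fcomp g f) x = act g (act f x) }.

Record mor (V W : cmodule) := Mor {
  mfun :> forall i : C, {linear V i -> W i};
  mor_nat : forall (i j : C) (f : fhom i j) x,
    mfun j (act V f x) = act W f (mfun i x) }.

Lemma mor_ext (V W : cmodule) (f g : mor V W) :
  (forall i x, f i x = g i x) -> f = g.
Proof.
case: f g => [f nf] [g ng] /= e.
have {}e : f = g by apply: functional_extensionality_dep => i; apply: lin_ext => x; exact: e.
by subst g; rewrite (Prop_irrelevance nf ng).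
Qed.

Lemma id_linear (U : lmodType k) : linear (fun x : U => x).
Proof. by []. Qed.

Program Definition mor_id (V : cmodule) : mor V V :=
  @Mor V V (fun i => mklin (@id_linear (V i))) _.

Program Definition mor_comp (V W X : cmodule) (g : mor W X) (f : mor V W) :
    mor V X :=
  @Mor V X (fun i => g i \o f i : {linear V i -> X i}) _.
Next Obligation. by rewrite !mor_nat. Qed.

Program Definition Cmod : category :=
  @Category cmodule mor mor_id mor_comp _ _ _.
Next Obligation. by apply: mor_ext. Qed.
Next Obligation. by apply: mor_ext. Qed.
Next Obligation. by apply: mor_ext. Qed.

Definition mor_inj (V W : cmodule) (f : mor V W) := forall i, injective (f i).
Definition mor_surj (V W : cmodule) (f : mor V W) :=
  forall i y, exists x, f i x = y.

Record submod (V : cmodule) := Submod {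
  smem :> forall i : C, set (V i);
  submod0 : forall i, @smem i 0;
  submodP : forall i a x y, @smem i x -> @smem i y -> @smem i (a *: x + y);
  submod_act : forall (i j : C) (f : fhom i j) x,
    @smem i x -> @smem j (act V f x) }.

(* Finite families of homogeneous elements suffice for both notions: the
   homogeneous components of finitely many elements of the graded A-module
   are finite in number. *)
Definition fin_gen (V : cmodule) : Prop :=
  exists n (g : 'I_n -> {i : C & V i}),
    forall S : submod V, (forall t, S (tag (g t)) (tagged (g t))) ->
    forall i x, S i x.

Definition fin_dim (V : cmodule) : Prop :=
  exists n (g : 'I_n -> {i : C & V i}),
    forall S : (forall i, set (V i)),
      (forall i, S i 0) ->
      (forall i a x y, S i x -> S i y -> S i (a *: x + y)) ->
      (forall t, S (tag (g t)) (tagged (g t))) ->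
    forall i x, S i x.

Definition helt (V : cmodule) (i : C) (x : V i) : {i : C & V i} :=
  existT (fun i => V i : Type) i x.

Lemma fin_dim_gen V : fin_dim V -> fin_gen V.
Proof.
move=> [n [g Hg]]; exists n, g => S HS.
by apply: Hg HS; [exact: submod0 | exact: submodP].
Qed.

Definition fgmod : category := full_subcategory (A := Cmod) fin_gen.

Definition fdmod : category :=
  full_subcategory (A := fgmod) (fun V => fin_dim (sval V)).

Section SubQuot.
Variables (V : cmodule) (S : submod V).

Definition spred i : {pred V i} := fun x => `[< S i x >].
Arguments spred : clear implicits.

Lemma spredE i x : (x \in spred i) = `[< S i x >].
Proof. by []. Qed.

Lemma spred_closed i : submod_closed (spred i).
Proof.
split=> [|a x y]; rewrite !spredE; first by apply/asboolP/submod0.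
by move=> /asboolP Sx /asboolP Sy; apply/asboolP/submodP.
Qed.

HB.instance Definition _ i :=
  GRing.isSubmodClosed.Build k (V i) (spred i) (@spred_closed i).

Definition sub_ob i := {x : V i | x \in spred i}.
HB.instance Definition _ i := Choice.on (sub_ob i).
HB.instance Definition _ i := SubType.on (sub_ob i).
HB.instance Definition _ i := [SubChoice_isSubLmodule of sub_ob i by <:].

Lemma sub_obP i (x : sub_ob i) : S i (val x).
Proof. by apply/asboolP; exact: (valP x). Qed.

Definition mksub i x (Sx : S i x) : sub_ob i := Sub x (asboolT Sx).

Lemma sub_act_subproof (i j : C) (f : fhom i j) (x : sub_ob i) :
  S j (act V f (val x)).
Proof. by apply: submod_act; apply: sub_obP. Qed.

Definition sub_act_fun (i j : C) (f : fhom i j) (x : sub_ob i) : sub_ob j :=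
  mksub (sub_act_subproof f x).

Lemma sub_act_linear (i j : C) (f : fhom i j) : linear (sub_act_fun f).
Proof. by move=> a x y; apply: val_inj; rewrite /= !linearP. Qed.

Program Definition subm : cmodule :=
  @CModule (fun i => sub_ob i : lmodType k)
    (fun i j f => mklin (sub_act_linear f)) _ _.
Next Obligation. by apply: val_inj; rewrite /= act_id. Qed.
Next Obligation. by apply: val_inj; rewrite /= act_comp. Qed.

Definition quot_ob i := Quotient.quot (spred i).
HB.instance Definition _ i := GRing.Zmodule.on (quot_ob i).

Definition qpi i (x : V i) : quot_ob i := \pi_(Quotient.quot (spred i))%qT x.

Lemma qpiE i (x y : V i) : (qpi x = qpi y) <-> S i (x - y).
Proof.
split=> [/eqP|h].
  by rewrite -Quotient.idealrBE => /asboolP.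
by apply/eqP; rewrite -Quotient.idealrBE; apply/asboolP.
Qed.

Lemma qpi_surj i (u : quot_ob i) : exists x, qpi x = u.
Proof. by exists (repr u); rewrite /qpi reprK. Qed.

Definition quot_scale i (a : k) (u : quot_ob i) : quot_ob i :=
  qpi (a *: repr u).

Lemma quot_scaleE i a (x : V i) : quot_scale a (qpi x) = qpi (a *: x).
Proof.
apply/qpiE; rewrite -scalerBr -[X in S i X]addr0; apply: submodP (submod0 _ _).
by apply/qpiE; rewrite /qpi reprK.
Qed.

Lemma quot_scaleA i a b (u : quot_ob i) :
  quot_scale a (quot_scale b u) = quot_scale (a * b) u.
Proof. by have [x <-] := qpi_surj u; rewrite !quot_scaleE scalerA. Qed.

Lemma quot_scale1 i : left_id 1 (@quot_scale i).
Proof.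
by move=> u; have [x <-] := qpi_surj u; rewrite !quot_scaleE scale1r.
Qed.

Lemma qpiD i (x y : V i) : qpi x + qpi y = qpi (x + y).
Proof. by rewrite /qpi raddfD. Qed.

Lemma quot_scaleDr i : right_distributive (@quot_scale i) +%R.
Proof.
move=> a u v; have [x <-] := qpi_surj u; have [y <-] := qpi_surj v.
by rewrite qpiD !quot_scaleE qpiD scalerDr.
Qed.

Lemma quot_scaleDl i (u : quot_ob i) :
  {morph (@quot_scale i)^~ u : a b / a + b}.
Proof.
by move=> a b; have [x <-] := qpi_surj u; rewrite !quot_scaleE qpiD scalerDl.
Qed.

HB.instance Definition _ i := GRing.Zmodule_isLmodule.Build k (quot_ob i)
  (@quot_scaleA i) (@quot_scale1 i) (@quot_scaleDr i) (@quot_scaleDl i).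

Lemma qpi_linear i : linear (@qpi i).
Proof. by move=> a x y; rewrite -qpiD -quot_scaleE. Qed.

Definition quot_act_fun (i j : C) (f : fhom i j) (u : quot_ob i) : quot_ob j :=
  qpi (act V f (repr u)).

Lemma quot_actE (i j : C) (f : fhom i j) x :
  quot_act_fun f (qpi x) = qpi (act V f x).
Proof.
by apply/qpiE; rewrite -linearB; apply/submod_act/qpiE; rewrite /qpi reprK.
Qed.

Lemma quot_act_linear (i j : C) (f : fhom i j) : linear (quot_act_fun f).
Proof.
move=> a u v; have [x <-] := qpi_surj u; have [y <-] := qpi_surj v.
by rewrite -qpi_linear !quot_actE linearP qpi_linear.
Qed.

Program Definition quotm : cmodule :=
  @CModule (fun i => quot_ob i : lmodType k)
    (fun i j f => mklin (quot_act_linear f)) _ _.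
Next Obligation.
by have [y <-] := qpi_surj x; rewrite quot_actE act_id.
Qed.
Next Obligation.
by have [y <-] := qpi_surj x; rewrite !quot_actE act_comp.
Qed.

Lemma val_linear i : linear (val : sub_ob i -> V i).
Proof. by move=> a x y; rewrite linearP. Qed.

Program Definition sub_incl : mor subm V :=
  @Mor subm V (fun i => mklin (@val_linear i)) _.

Program Definition quot_proj : mor V quotm :=
  @Mor V quotm (fun i => mklin (@qpi_linear i)) _.
Next Obligation. by rewrite quot_actE. Qed.

Lemma sub_incl_inj : mor_inj sub_incl.
Proof. by move=> i x y; apply: val_inj. Qed.

Lemma sub_inclP i (x : subm i) : S i (sub_incl i x).
Proof. exact: sub_obP. Qed.

Lemma sub_incl_onto i x : S i x -> exists u, sub_incl i u = x.
Proof. by move=> Sx; exists (mksub Sx). Qed.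

Lemma quot_proj_surj : mor_surj quot_proj.
Proof. exact: qpi_surj. Qed.

Lemma quot_projE i (x : V i) : quot_proj i x = 0 <-> S i x.
Proof.
by rewrite -[X in _ = X](linear0 (quot_proj i)) -[X in _ <-> S i X]subr0 -qpiE.
Qed.
End SubQuot.

Program Definition preim (V W : cmodule) (f : mor V W) (S : submod W) :
    submod V := @Submod V (fun i x => S i (f i x)) _ _ _.
Next Obligation. by rewrite linear0; apply: submod0. Qed.
Next Obligation. by rewrite linearP; apply: submodP. Qed.
Next Obligation. by rewrite mor_nat; apply: submod_act. Qed.

#[local] Obligation Tactic := idtac.

Program Definition image (V W : cmodule) (f : mor V W) (S : submod V) :
    submod W := @Submod W (fun i y => exists2 x, S i x & f i x = y) _ _ _.
Next Obligation.
by move=> V W f S i; exists 0; [apply: submod0 | rewrite linear0].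
Qed.
Next Obligation.
move=> V W f S i a _ _ [x Sx <-] [y Sy <-].
by exists (a *: x + y); [apply: submodP | rewrite linearP].
Qed.
Next Obligation.
move=> V W f S i j p _ [x Sx <-].
by exists (act V p x); [apply: submod_act | rewrite mor_nat].
Qed.

Program Definition join (V : cmodule) (S T : submod V) : submod V :=
  @Submod V (fun i x => exists y z, [/\ S i y, T i z & x = y + z]) _ _ _.
Next Obligation.
by move=> V S T i; exists 0, 0; split; rewrite ?addr0 //; apply: submod0.
Qed.
Next Obligation.
move=> V S T i a _ _ [y [z [Sy Tz ->]]] [y' [z' [Sy' Tz' ->]]].
exists (a *: y + y'), (a *: z + z'); split; try exact: submodP.
by rewrite scalerDr addrACA.
Qed.
Next Obligation.
move=> V S T i j p _ [y [z [Sy Tz ->]]].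
exists (act V p y), (act V p z).
by split; rewrite ?linearD //; apply: submod_act.
Qed.

#[local] Obligation Tactic := Program.Tactics.program_simpl.

Program Definition fullm (V : cmodule) : submod V :=
  @Submod V (fun _ _ => True) _ _ _.

Program Definition nullm (V : cmodule) : submod V :=
  @Submod V (fun _ x => x = 0) _ _ _.
Next Obligation. by rewrite scaler0 addr0. Qed.
Next Obligation. by rewrite linear0. Qed.

Definition ker (V W : cmodule) (f : mor V W) := preim f (nullm W).

Program Definition cap (V : cmodule) (S T : submod V) : submod V :=
  @Submod V (fun i x => S i x /\ T i x) _ _ _.
Next Obligation. by split; apply: submod0. Qed.
Next Obligation. by split; apply: submodP. Qed.
Next Obligation. by split; apply: submod_act. Qed.

Lemma submodD (V : cmodule) (S : submod V) i x y :
  S i x -> S i y -> S i (x + y).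
Proof. by move=> Sx Sy; rewrite -[x]scale1r; apply: submodP. Qed.

Lemma submodN (V : cmodule) (S : submod V) i x : S i x -> S i (- x).
Proof.
by move=> Sx; rewrite -scaleN1r -[X in S i X]addr0; apply: submodP (submod0 _ _).
Qed.

Lemma submodB (V : cmodule) (S : submod V) i x y :
  S i x -> S i y -> S i (x - y).
Proof. by move=> Sx /submodN; apply: submodD. Qed.

Lemma factor_surj (V W E : cmodule) (g : mor V W) (f : mor V E) :
    mor_surj g -> (forall i x, g i x = 0 -> f i x = 0) ->
  exists h : mor W E, forall i x, h i (g i x) = f i x.
Proof.
move=> gs gf.
have gfE i x y : g i x = g i y -> f i x = f i y.
  move=> e; apply/eqP; rewrite -subr_eq0 -linearB; apply/eqP/gf.
  by rewrite linearB e subrr.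
pose h i (w : W i) : E i := f i (sval (cid (gs i w))).
have hE i x : h i (g i x) = f i x by rewrite /h; case: cid => y /= /gfE.
have hl i : linear (h i).
  move=> a u v; have [x <-] := gs i u; have [y <-] := gs i v.
  by rewrite -linearP !hE linearP.
have hn (i j : C) (p : fhom i j) u :
    mklin (hl j) (act W p u) = act E p (mklin (hl i) u).
  by have [x <-] := gs i u; rewrite /= -mor_nat !hE mor_nat.
by exists (Mor hn) => i x; rewrite /= hE.
Qed.

Lemma factor_inj (U V E : cmodule) (j : mor U V) (f : mor E V) :
    mor_inj j -> (forall i x, exists u, j i u = f i x) ->
  exists h : mor E U, forall i x, j i (h i x) = f i x.
Proof.
move=> ji jf.
pose h i (x : E i) : U i := sval (cid (jf i x)).
have hE i x : j i (h i x) = f i x by rewrite /h; case: cid.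
have hl i : linear (h i).
  by move=> a u v; apply: (ji i); rewrite linearP !hE linearP.
have hn (i i' : C) (p : fhom i i') u :
    mklin (hl i') (act E p u) = act U p (mklin (hl i) u).
  by apply: (ji i'); rewrite mor_nat /= !hE mor_nat.
by exists (Mor hn) => i x; rewrite /= hE.
Qed.

Lemma fin_gen_surj (V W : cmodule) (g : mor V W) :
  mor_surj g -> fin_gen V -> fin_gen W.
Proof.
move=> gs [n [x Hx]]; exists n, (fun t => helt (g _ (tagged (x t)))).
move=> S HS i w; have [v <-] := gs i w.
exact: (Hx (preim g S) HS i v).
Qed.

Section DirectSum.
Variables V W : cmodule.

Lemma dsum_act_linear (i j : C) (f : fhom i j) :
  linear (fun x : (V i * W i)%type => (act V f x.1, act W f x.2)).
Proof. by move=> a x y; rewrite /= !linearP. Qed.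

Program Definition dsum : cmodule :=
  @CModule (fun i => (V i * W i)%type : lmodType k)
    (fun i j f => mklin (@dsum_act_linear i j f)) _ _.
Next Obligation. by rewrite /= !act_id. Qed.
Next Obligation. by rewrite /= !act_comp. Qed.

Lemma fst_linear i : linear (fun x : (V i * W i)%type => x.1).
Proof. by []. Qed.
Lemma snd_linear i : linear (fun x : (V i * W i)%type => x.2).
Proof. by []. Qed.
Lemma inl_linear i : linear (fun x : V i => (x, 0 : W i)).
Proof.
by move=> a x y; congr pair; rewrite /= scaler0 addr0.
Qed.
Lemma inr_linear i : linear (fun y : W i => (0 : V i, y)).
Proof.
by move=> a x y; congr pair; rewrite /= scaler0 addr0.
Qed.

Program Definition dsum_fst : mor dsum V :=
  @Mor dsum V (fun i => mklin (@fst_linear i)) _.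
Program Definition dsum_snd : mor dsum W :=
  @Mor dsum W (fun i => mklin (@snd_linear i)) _.
Program Definition dsum_inl : mor V dsum :=
  @Mor V dsum (fun i => mklin (@inl_linear i)) _.
Next Obligation. by rewrite /= linear0. Qed.
Program Definition dsum_inr : mor W dsum :=
  @Mor W dsum (fun i => mklin (@inr_linear i)) _.
Next Obligation. by rewrite /= linear0. Qed.

Lemma fin_gen_dsum : fin_gen V -> fin_gen W -> fin_gen dsum.
Proof.
move=> [n [g Hg]] [m [h Hh]]; exists (n + m)%N, (fun t => match split t with
  | inl a => helt (dsum_inl _ (tagged (g a)))
  | inr b => helt (dsum_inr _ (tagged (h b))) end).
move=> S HS i [x y].
have -> : (x, y) = dsum_inl i x + dsum_inr i y :> dsum i.
  by congr pair; rewrite /= ?addr0 ?add0r.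
apply: submodD.
  apply: (Hg (preim dsum_inl S)) => t; have := HS (unsplit (inl t)).
  by rewrite unsplitK.
apply: (Hh (preim dsum_inr S)) => t; have := HS (unsplit (inr t)).
by rewrite unsplitK.
Qed.
End DirectSum.

Definition locally_noetherian : Prop :=
  forall V : cmodule, fin_gen V -> forall S : submod V, fin_gen (subm S).

Definition injective_module (E : cmodule) : Prop :=
  forall (V W : cmodule) (f : mor V W) (g : mor V E), mor_inj f ->
  exists h : mor W E, mor_comp h f = g.

Definition short_exact (U V W : cmodule) (f : mor U V) (g : mor V W) : Prop :=
  [/\ mor_inj f, mor_surj g &
      forall i y, g i y = 0 <-> exists x, f i x = y].

Record serre (S : fgmod -> Prop) : Prop := Serre {
  serre0 : forall V : fgmod, (forall i (x : sval V i), x = 0) -> S V;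
  serre_ses : forall (U V W : fgmod) (f : hom U V) (g : hom V W),
    short_exact f g -> S V <-> S U /\ S W }.

Section SerreQuotient.
Hypothesis noeth : locally_noetherian.
Variable S : fgmod -> Prop.
Hypothesis hS : serre S.

Definition fgquot (X : fgmod) (A : submod (sval X)) : fgmod :=
  exist _ (quotm A) (fin_gen_surj (@quot_proj_surj _ A) (svalP X)).

Definition fgsub (X : fgmod) (A : submod (sval X)) : fgmod :=
  exist _ (subm A) (noeth (svalP X) A).

Lemma serre_inj (X Y : fgmod) (f : mor (sval X) (sval Y)) :
  mor_inj f -> S Y -> S X.
Proof.
move=> fi SY; pose A := image f (fullm (sval X)).
have /(serre_ses hS) : short_exact
    (f : hom X Y) (quot_proj A : hom Y (fgquot A)).
  split=> //; first exact: quot_proj_surj.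
  move=> i y; rewrite quot_projE.
  by split=> [[x _ <-]|[x <-]]; exists x.
by case=> /(_ SY)[].
Qed.

Lemma serre_surj (X Y : fgmod) (f : mor (sval X) (sval Y)) :
  mor_surj f -> S X -> S Y.
Proof.
move=> fs SX.
have /(serre_ses hS) : short_exact
    (sub_incl (ker f) : hom (@fgsub X (ker f)) X) (f : hom X Y).
  split=> //; first exact: sub_incl_inj.
  move=> i y; split=> [fy|[x <-]]; first exact: (@sub_incl_onto _ (ker f)).
  exact: (@sub_inclP _ (ker f)).
by case=> /(_ SX)[].
Qed.

Lemma serre_exact (X Y Z : fgmod) (f : mor (sval X) (sval Y))
    (g : mor (sval Y) (sval Z)) :
  (forall i y, g i y = 0 -> exists x, f i x = y) -> S X -> S Z -> S Y.
Proof.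
move=> ex SX SZ.
have /(serre_ses hS) : short_exact
    (sub_incl (ker g) : hom (@fgsub Y (ker g)) Y)
    (quot_proj (ker g) : hom Y (@fgquot Y (ker g))).
  split; [exact: sub_incl_inj|exact: quot_proj_surj|move=> i y].
  rewrite quot_projE; split=> [|[x <-]]; first exact: sub_incl_onto.
  exact: sub_inclP.
case=> _; apply; split.
  pose A : submod (sval X) := ker (mor_comp g f).
  have SA : S (fgsub A) by apply: serre_inj SX; exact: sub_incl_inj.
  have [|h hE] := @factor_inj _ _ _ (sub_incl (ker g))
      (mor_comp f (sub_incl A)) (@sub_incl_inj _ _).
    by move=> i x; apply: sub_incl_onto; exact: (@sub_inclP _ A i x).
  apply: (@serre_surj (fgsub A) (@fgsub Y (ker g)) h _ SA) => i y.
  have [x xE] := ex i _ (@sub_inclP _ (ker g) i y).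
  have [|u uE] := @sub_incl_onto _ A i x.
    by rewrite /A /ker /= xE; exact: (@sub_inclP _ (ker g) i y).
  by exists u; apply: (@sub_incl_inj _ (ker g) i); rewrite hE -xE -uE.
have [|h hE] := @factor_surj _ _ _ (quot_proj (ker g)) g
    (@quot_proj_surj _ _).
  by move=> i x /quot_projE.
apply: (@serre_inj (@fgquot Y (ker g)) Z h _ SZ) => i u v.
have [x <-] := quot_proj_surj u; have [y <-] := quot_proj_surj v.
rewrite !hE => e; apply/qpiE; rewrite /ker /=.
by rewrite linearB e subrr.
Qed.

Definition dense (X : fgmod) (A : submod (sval X)) : Prop := S (fgquot A).
Definition small (X : fgmod) (A : submod (sval X)) : Prop := S (fgsub A).
Arguments dense : clear implicits.
Arguments small : clear implicits.

Definition sub_le (V : cmodule) (A B : submod V) : Prop :=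
  forall i x, A i x -> B i x.

Lemma dense_preim (X Y : fgmod) (f : mor (sval X) (sval Y)) E :
  dense Y E -> dense X (preim f E).
Proof.
have [|h hE] := @factor_surj _ _ _ (quot_proj (preim f E))
    (mor_comp (quot_proj E) f) (@quot_proj_surj _ _).
  by move=> i x /quot_projE fx; apply/quot_projE.
apply: (@serre_inj (@fgquot X (preim f E)) (@fgquot Y E) h) => i u v.
have [x <-] := quot_proj_surj u; have [y <-] := quot_proj_surj v.
rewrite !hE => /qpiE Exy; apply/qpiE.
by rewrite /= linearB.
Qed.

Lemma dense_image (X Y : fgmod) (f : mor (sval X) (sval Y)) D :
  dense Y (image f (fullm (sval X))) -> dense X D -> dense Y (image f D).
Proof.
set T := image f (fullm _).
have [|h hE] := @factor_surj _ _ _ (quot_proj D)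
    (mor_comp (quot_proj (image f D)) f) (@quot_proj_surj _ _).
  by move=> i x /quot_projE Dx; apply/quot_projE; exists x.
have [|g gE] := @factor_surj _ _ _ (quot_proj (image f D))
    (quot_proj T) (@quot_proj_surj _ _).
  by move=> i x /quot_projE [y _ <-]; apply/quot_projE; exists y.
move=> dT dD.
apply: (@serre_exact (@fgquot X D) (@fgquot Y (image f D)) (@fgquot Y T)
          h g _ dD dT) => i u.
have [y <-] := quot_proj_surj u; rewrite gE => /quot_projE [x _ <-].
by exists (quot_proj D i x); rewrite hE.
Qed.

Lemma dense_le (X : fgmod) A B : sub_le A B -> dense X A -> dense X B.
Proof.
move=> AB; have [|h hE] := @factor_surj _ _ _ (quot_proj A)
    (quot_proj B) (@quot_proj_surj _ _).
  by move=> i x /quot_projE /AB Bx; apply/quot_projE.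
apply: (@serre_surj (@fgquot X A) (@fgquot X B) h) => i u.
by have [x <-] := quot_proj_surj u; exists (quot_proj A i x); rewrite hE.
Qed.

Lemma dense_full (X : fgmod) : dense X (fullm (sval X)).
Proof.
apply: (serre0 hS) => i u.
by have [x <-] := quot_proj_surj u; apply/quot_projE.
Qed.

Lemma dense_cap (X : fgmod) A B : dense X A -> dense X B -> dense X (cap A B).
Proof.
move=> dA dB; pose f : mor (sval (fgsub A)) (sval X) := sub_incl A.
apply: (@dense_le _ (image f (preim f B))).
  move=> i _ [x Bx <-]; split=> //; exact: (@sub_inclP _ A).
apply: dense_image; last exact: dense_preim.
apply: dense_le dA => i x Ax.
by have [u <-] := sub_incl_onto Ax; exists u.
Qed.

Lemma small_le (X : fgmod) A B : sub_le A B -> small X B -> small X A.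
Proof.
move=> AB; have [|h hE] := @factor_inj _ _ _ (sub_incl B) (sub_incl A)
    (@sub_incl_inj _ _).
  by move=> i x; apply: sub_incl_onto; apply: AB; apply: (@sub_inclP _ A).
apply: (@serre_inj (@fgsub X A) (@fgsub X B) h) => i x y exy.
by apply: (@sub_incl_inj _ A i); rewrite -!hE exy.
Qed.

Lemma small0 (X : fgmod) A : sub_le A (nullm _) -> small X A.
Proof.
move=> A0; apply: (serre0 hS) => i u.
by apply: (@sub_incl_inj _ A i); rewrite linear0; apply/A0/(@sub_inclP _ A).
Qed.

Lemma small_image (X Y : fgmod) (f : mor (sval X) (sval Y)) D :
  small X D -> small Y (image f D).
Proof.
have [|h hE] := @factor_inj _ _ _ (sub_incl (image f D))
    (mor_comp f (sub_incl D)) (@sub_incl_inj _ _).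
  move=> i x; apply: sub_incl_onto; exists (sub_incl D i x) => //.
  exact: (@sub_inclP _ D).
apply: (@serre_surj (@fgsub X D) (@fgsub Y (image f D)) h) => i y.
have [x Dx xy] := @sub_inclP _ _ i y; have [u ux] := sub_incl_onto Dx.
exists u; apply: (@sub_incl_inj _ (image f D) i).
by rewrite hE -xy -ux.
Qed.

Lemma small_preim (X Y : fgmod) (f : mor (sval X) (sval Y)) E :
  small X (ker f) -> small Y E -> small X (preim f E).
Proof.
move=> sK sE.
have [|h hE] := @factor_inj _ _ _ (sub_incl (preim f E))
    (sub_incl (ker f)) (@sub_incl_inj _ _).
  move=> i x; apply: sub_incl_onto => /=.
  by rewrite (@sub_inclP _ (ker f) i x); apply: submod0.
have [|g gE] := @factor_inj _ _ _ (sub_incl E)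
    (mor_comp f (sub_incl (preim f E))) (@sub_incl_inj _ _).
  by move=> i x; apply: sub_incl_onto; apply: (@sub_inclP _ (preim f E)).
apply: (@serre_exact (@fgsub X (ker f)) (@fgsub X (preim f E)) (@fgsub Y E)
          h g _ sK sE) => i y gy.
have [|u uy] := @sub_incl_onto _ (ker f) i (sub_incl (preim f E) i y).
  have := gE i y; rewrite gy linear0 => /esym; exact.
by exists u; apply: (@sub_incl_inj _ (preim f E) i); rewrite hE.
Qed.

Lemma small_join (X : fgmod) A B : small X A -> small X B -> small X (join A B).
Proof.
move=> sA sB; pose f : mor (sval X) (sval (fgquot A)) := quot_proj A.
apply: (@small_le _ _ (preim f (image f B))).
  move=> i x [y [z [Ay Bz ->]]]; exists z => //.
  by rewrite linearD; have /quot_projE -> := Ay; rewrite add0r.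
apply: small_preim; last exact: small_image.
by apply: small_le sA => i x /quot_projE.
Qed.

Definition fgdsum (X Y : fgmod) : fgmod :=
  exist _ (dsum (sval X) (sval Y)) (fin_gen_dsum (svalP X) (svalP Y)).

Section Relations.
Variables X Y : fgmod.
Implicit Type G : submod (dsum (sval X) (sval Y)).

#[local] Obligation Tactic := idtac.

Program Definition dom G : submod (sval X) :=
  @Submod (sval X) (fun i x => exists y, G i (x, y)) _ _ _.
Next Obligation. by move=> G i; exists 0; apply: (submod0 G). Qed.
Next Obligation.
move=> G i a x x' [y Gy] [y' Gy']; exists (a *: y + y').
exact: (submodP a Gy Gy').
Qed.
Next Obligation.
move=> G i j f x [y Gy]; exists (act (sval Y) f y).
exact: (submod_act f Gy).
Qed.

Definition indet G : submod (sval Y) := preim (dsum_inr _ _) G.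

Definition rel_img G (D : submod (sval X)) : submod (sval Y) :=
  image (dsum_snd _ _) (cap G (preim (dsum_fst _ _) D)).
Definition rel_pre G (E : submod (sval Y)) : submod (sval X) :=
  image (dsum_fst _ _) (cap G (preim (dsum_snd _ _) E)).

Lemma rel_imgP G D i y : rel_img G D i y <-> exists2 x, D i x & G i (x, y).
Proof.
split=> [[[x y'] [Gxy Dx] <-]|[x Dx Gxy]]; first by exists x.
by exists (x, y).
Qed.

Lemma rel_preP G E i x : rel_pre G E i x <-> exists2 y, E i y & G i (x, y).
Proof.
split=> [[[x' y] [Gxy Ey] <-]|[y Ey Gxy]]; first by exists y.
by exists (x, y).
Qed.

Lemma dense_pre G E : dense X (dom G) -> dense Y E -> dense X (rel_pre G E).
Proof.
move=> dG dE.
pose p : mor (sval (@fgsub (fgdsum X Y) G)) (sval X) :=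
  mor_comp (dsum_fst _ _) (sub_incl G).
pose q : mor (sval (@fgsub (fgdsum X Y) G)) (sval Y) :=
  mor_comp (dsum_snd _ _) (sub_incl G).
apply: (@dense_le _ (image p (preim q E))).
  move=> i _ [u Eu <-]; apply/rel_preP; exists (q i u) => //.
  by rewrite -surjective_pairing; apply: (@sub_inclP _ G i u).
apply: dense_image; last exact: dense_preim.
apply: dense_le dG => i x [y Gxy].
by have [u uE] := sub_incl_onto Gxy; exists u => //; exact: (congr1 fst uE).
Qed.

Lemma small_img G D : small Y (indet G) -> small X D -> small Y (rel_img G D).
Proof.
move=> sG sD.
pose p : mor (sval (@fgsub (fgdsum X Y) G)) (sval X) :=
  mor_comp (dsum_fst _ _) (sub_incl G).
pose q : mor (sval (@fgsub (fgdsum X Y) G)) (sval Y) :=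
  mor_comp (dsum_snd _ _) (sub_incl G).
apply: (@small_le _ _ (image q (preim p D))).
  move=> i y /rel_imgP [x Dx Gxy]; have [u uE] := sub_incl_onto Gxy.
  exists u; last exact: (congr1 snd uE).
  by have /= -> := congr1 fst uE.
apply: small_image; apply: small_preim sD.
have [|h hE] := @factor_inj _ _ _ (sub_incl (indet G))
    (mor_comp q (sub_incl (ker p))) (@sub_incl_inj _ _).
  move=> i x; apply: sub_incl_onto.
  have /= p0 := @sub_inclP _ (ker p) i x.
  have := @sub_inclP _ G i (sub_incl (ker p) i x).
  by rewrite /= [X in G i X]surjective_pairing p0.
apply: (@serre_inj (@fgsub (@fgsub (fgdsum X Y) G) (ker p))
          (@fgsub Y (indet G)) h _ sG) => i x y exy.
apply: (@sub_incl_inj _ (ker p) i); apply: (@sub_incl_inj _ G i).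
have /= px := @sub_inclP _ (ker p) i x.
have /= py := @sub_inclP _ (ker p) i y.
have := hE i x; rewrite exy hE /= => e.
by rewrite /= [LHS]surjective_pairing [RHS]surjective_pairing px py e.
Qed.
End Relations.

(* Gabriel's construction: Hom(X, Y) in the quotient is the colimit of the
   Hom(X', Y/Y') over the X' <= X and Y' <= Y with X/X' and Y' in S. A morphism
   f : X' -> Y/Y' is encoded by its graph {(x, y) | x \in X', f x = y + Y'};
   conversely every submodule G of X (+) Y is the graph of a unique such
   morphism, with X' = [dom G] and Y' = [indet G]. *)
Record frac (X Y : fgmod) := Frac {
  graph : submod (dsum (sval X) (sval Y));
  dense_dom : dense X (dom graph);
  small_indet : small Y (indet graph) }.

HB.instance Definition _ X Y := gen_eqMixin (frac X Y).
HB.instance Definition _ X Y := gen_choiceMixin (frac X Y).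

(* Equality in colim Hom(X', Y/Y'): the two morphisms induce the same map
   A -> Y/B for some smaller A <= X and larger B <= Y. *)
Definition frac_eq (X Y : fgmod) (F G : frac X Y) : Prop :=
  exists (A : submod (sval X)) (B : submod (sval Y)),
    [/\ dense X A, sub_le A (dom (graph F)) & sub_le A (dom (graph G))] /\
    [/\ small Y B, sub_le (indet (graph F)) B & sub_le (indet (graph G)) B] /\
    (forall i x y y', A i x -> graph F i (x, y) -> graph G i (x, y') ->
       B i (y - y')).

Lemma graphB (X Y : fgmod) (G : submod (dsum (sval X) (sval Y))) i x y y' :
  G i (x, y) -> G i (x, y') -> indet G i (y - y').
Proof.
move=> Gy Gy' /=.
have <- : (x, y) - (x, y') = (0, y - y') :> dsum (sval X) (sval Y) i.
  by congr pair; exact: subrr.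
exact: submodB.
Qed.

Lemma frac_eq_refl X Y (F : frac X Y) : frac_eq F F.
Proof.
exists (dom (graph F)), (indet (graph F)); split; [|split].
- by split=> //; exact: dense_dom.
- by split=> //; exact: small_indet.
- by move=> i x y y' _; apply: graphB.
Qed.

Lemma frac_eq_sym X Y (F G : frac X Y) : frac_eq F G -> frac_eq G F.
Proof.
move=> [A [B [[dA AF AG] [[sB FB GB] H]]]]; exists A, B; do ![split=> //].
by move=> i x y y' Ax Gy Fy'; rewrite -opprB; apply/submodN/(H _ x).
Qed.

Lemma frac_eq_trans X Y (F G H : frac X Y) :
  frac_eq F G -> frac_eq G H -> frac_eq F H.
Proof.
move=> [A [B [[dA AF AG] [[sB FB GB] FG]]]].
move=> [A' [B' [[dA' AG' AH'] [[sB' GB' HB'] GH]]]].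
exists (cap A A'), (join B B'); split; [|split].
- split; first exact: dense_cap; by move=> i x [? ?]; auto.
- split; first exact: small_join.
    by move=> i x /FB Bx; exists x, 0; split; rewrite ?addr0 //; apply: submod0.
  by move=> i x /HB' Bx; exists 0, x; split; rewrite ?add0r //; apply: submod0.
- move=> i x y y' [Ax A'x] Fy Hy'; have [z Gz] := AG _ _ Ax.
  exists (y - z), (z - y'); split; [exact: FG Fy Gz|exact: GH Gz Hy'|].
  by rewrite addrA subrK.
Qed.

Definition frac_rel X Y : rel (frac X Y) := fun F G => `[< frac_eq F G >].

Lemma frac_rel_equiv X Y : equiv_class_of (@frac_rel X Y).
Proof.
split=> [F|F G|G F H]; first exact/asboolP/frac_eq_refl.
  by apply/asboolP/asboolP; apply: frac_eq_sym.
by move=> /asboolP FG /asboolP GH; apply/asboolP/(frac_eq_trans FG).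
Qed.

Canonical frac_equiv X Y := EquivRelPack (@frac_rel_equiv X Y).

Definition serre_hom (X Y : fgmod) : Type := {eq_quot (frac_equiv X Y)}%qT.

Definition frac_class X Y (F : frac X Y) : serre_hom X Y :=
  \pi_({eq_quot (frac_equiv X Y)})%qT F.

Definition frac_repr X Y (u : serre_hom X Y) : frac X Y := repr u.

Lemma frac_reprK X Y (u : serre_hom X Y) : frac_class (frac_repr u) = u.
Proof. by rewrite /frac_class /frac_repr reprK. Qed.

Lemma frac_classE X Y (F G : frac X Y) :
  frac_class F = frac_class G <-> frac_eq F G.
Proof.
split=> [/eqmodP /asboolP //|h]; by apply/eqmodP/asboolP.
Qed.

Lemma frac_class_repr X Y (F : frac X Y) : frac_eq (frac_repr (frac_class F)) F.
Proof. by apply/frac_classE; rewrite frac_reprK. Qed.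

(* In terms of graphs, the composite of f : X' -> Y/Y' and g : Y'' -> Z/Z',
   namely f^-1((Y' + Y'')/Y') -> Y''/(Y' :&: Y'') -> Z/(Z' + g(Y' :&: Y'')), is the
   composite of relations. *)
Section GraphComp.
Variables X Y Z : fgmod.
#[local] Obligation Tactic := idtac.

Program Definition graph_comp (H : submod (dsum (sval Y) (sval Z)))
    (G : submod (dsum (sval X) (sval Y))) : submod (dsum (sval X) (sval Z)) :=
  @Submod (dsum (sval X) (sval Z))
    (fun i p => exists y, G i (p.1, y) /\ H i (y, p.2)) _ _ _.
Next Obligation.
by move=> H G i; exists 0; split; [exact: (submod0 G)|exact: (submod0 H)].
Qed.
Next Obligation.
move=> H G i a [x z] [x' z'] /= [y [Gy Hy]] [y' [Gy' Hy']].
by exists (a *: y + y'); split; [exact: (submodP a Gy Gy')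
                                |exact: (submodP a Hy Hy')].
Qed.
Next Obligation.
move=> H G i j f [x z] /= [y [Gy Hy]]; exists (act (sval Y) f y).
by split; [exact: (submod_act f Gy)|exact: (submod_act f Hy)].
Qed.

Lemma dense_dom_comp (H : frac Y Z) (G : frac X Y) :
  dense X (dom (graph_comp (graph H) (graph G))).
Proof.
apply: (@dense_le _ (rel_pre (graph G) (dom (graph H)))).
  by move=> i x /rel_preP [y [z Hz] Gy]; exists z, y.
by apply: dense_pre; exact: dense_dom.
Qed.

Lemma small_indet_comp (H : frac Y Z) (G : frac X Y) :
  small Z (indet (graph_comp (graph H) (graph G))).
Proof.
apply: (@small_le _ _ (rel_img (graph H) (indet (graph G)))).
  by move=> i z [y [Gy Hz]]; apply/rel_imgP; exists y.
by apply: small_img; exact: small_indet.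
Qed.

Definition frac_comp (H : frac Y Z) (G : frac X Y) : frac X Z :=
  Frac (dense_dom_comp H G) (small_indet_comp H G).

Lemma frac_comp_eq (H H' : frac Y Z) (G G' : frac X Y) :
  frac_eq H H' -> frac_eq G G' -> frac_eq (frac_comp H G) (frac_comp H' G').
Proof.
move=> [A' [B' [[dA' AH AH'] [[sB' HB HB'] HH]]]].
move=> [A [B [[dA AG AG'] [[sB GB GB'] GG]]]].
exists (cap A (cap (rel_pre (graph G) A') (rel_pre (graph G') A'))).
exists (join (rel_img (graph H) B) (join B' (rel_img (graph H') B))).
split; [|split].
- split.
  + apply: dense_cap => //; apply: dense_cap; apply: dense_pre => //;
    exact: dense_dom.
  + move=> i x [_ [/rel_preP [y /AH [z Hz] Gy] _]].
    by exists z, y.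
  + move=> i x [_ [_ /rel_preP [y /AH' [z Hz] Gy]]].
    by exists z, y.
- split.
  + apply: small_join; first by apply: small_img => //; exact: small_indet.
    apply: small_join => //; apply: small_img => //; exact: small_indet.
  + move=> i z [y [/GB By Hz]]; exists z, 0; split; rewrite ?addr0 //.
      by apply/rel_imgP; exists y.
    exact: (submod0 (join _ _)).
  + move=> i z [y [/GB' By Hz]]; exists 0, z; split; rewrite ?add0r //.
      exact: submod0.
    exists 0, z; split; rewrite ?add0r //; first exact: submod0.
    by apply/rel_imgP; exists y.
- move=> i x z z' [Ax [/rel_preP [u A'u Gu] _]] [y [Gy Hz]] [y' [Gy' Hz']].
  rewrite /= in Gy Hz Gy' Hz'.
  have [[w Hw] [w' Hw']] := (AH _ _ A'u, AH' _ _ A'u).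
  exists (z - w), (w - z'); split; last by rewrite addrA subrK.
    apply/rel_imgP; exists (y - u); last exact: (submodB Hz Hw).
    by apply: GB; apply: graphB Gy Gu.
  exists (w - w'), (w' - z'); split; last by rewrite addrA subrK.
    exact: HH Hw Hw'.
  apply/rel_imgP; exists (u - y'); last exact: (submodB Hw' Hz').
  exact: GG Gu Gy'.
Qed.
End GraphComp.

Section GraphOf.
Variables (X Y : fgmod) (f : mor (sval X) (sval Y)).
#[local] Obligation Tactic := idtac.

Program Definition graph_of : submod (dsum (sval X) (sval Y)) :=
  @Submod (dsum (sval X) (sval Y)) (fun i p => p.2 = f i p.1) _ _ _.
Next Obligation. by move=> i; rewrite /= linear0. Qed.
Next Obligation. by move=> i a [x y] [x' y'] /= -> ->; rewrite linearP. Qed.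
Next Obligation. by move=> i j p [x y] /= ->; rewrite mor_nat. Qed.

Lemma dense_dom_of : dense X (dom graph_of).
Proof. by apply: dense_le (@dense_full X) => i x _; exists (f i x). Qed.

Lemma small_indet_of : small Y (indet graph_of).
Proof. by apply: small0 => i y /=; rewrite linear0. Qed.

Definition frac_of : frac X Y := Frac dense_dom_of small_indet_of.
End GraphOf.

Definition serre_comp X Y Z (v : serre_hom Y Z) (u : serre_hom X Y) :
  serre_hom X Z := frac_class (frac_comp (frac_repr v) (frac_repr u)).

Lemma serre_compE X Y Z (H : frac Y Z) (G : frac X Y) :
  serre_comp (frac_class H) (frac_class G) = frac_class (frac_comp H G).
Proof. by apply/frac_classE/frac_comp_eq; apply: frac_class_repr. Qed.

Lemma frac_ext X Y (F G : frac X Y) :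
  (forall i p, graph F i p <-> graph G i p) -> frac_class F = frac_class G.
Proof.
move=> e; apply/frac_classE; have [A [B [[dA AF _] [[sB FB _] H]]]] :=
  frac_eq_refl F.
exists A, B; split; [|split].
- by split=> // i x /AF [y /e]; exists y.
- by split=> // i y /e /FB.
- by move=> i x y y' Ax Fy /e; apply: H.
Qed.

Lemma serre_comp_idl X Y (u : serre_hom X Y) :
  serre_comp (frac_class (frac_of (mor_id (sval Y)))) u = u.
Proof.
rewrite -(frac_reprK u) serre_compE; apply: frac_ext => i [x y] /=.
by split=> [[z [Gz ->]]|Gy]; last exists y.
Qed.

Lemma serre_comp_idr X Y (u : serre_hom X Y) :
  serre_comp u (frac_class (frac_of (mor_id (sval X)))) = u.
Proof.
rewrite -(frac_reprK u) serre_compE; apply: frac_ext => i [x y] /=.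
by split=> [[z [-> Gz]]|Gy]; last exists x.
Qed.

Lemma serre_compA X Y Z T (w : serre_hom Z T) (v : serre_hom Y Z)
    (u : serre_hom X Y) :
  serre_comp w (serre_comp v u) = serre_comp (serre_comp w v) u.
Proof.
rewrite -(frac_reprK u) -(frac_reprK v) -(frac_reprK w) !serre_compE.
apply: frac_ext => i [x t] /=; split.
  by move=> [z [[y [Gy Gz]] Gt]]; exists y; split=> //; exists z.
by move=> [y [Gy [z [Gz Gt]]]]; exists z; split=> //; exists y.
Qed.

Definition serre_quotient : category :=
  @Category fgmod serre_hom (fun X => frac_class (frac_of (mor_id (sval X))))
    serre_comp serre_comp_idl serre_comp_idr serre_compA.

Program Definition quotient_functor : functor fgmod serre_quotient :=
  @Functor fgmod serre_quotient (fun X => X)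
    (fun X Y f => frac_class (frac_of (f : mor (sval X) (sval Y)))) _ _.
Next Obligation.
rewrite serre_compE; apply: frac_ext => i [a b] /=.
by split=> [->|[c [-> ->]]] //; exists (f i a).
Qed.
End SerreQuotient.
End Modules.

Section HomModule.
Variables (k : fieldType) (C : fincat) (V W : cmodule k C).

HB.instance Definition _ := gen_eqMixin (mor V W).
HB.instance Definition _ := gen_choiceMixin (mor V W).

Program Definition mor_zero : mor V W :=
  @Mor k C V W (fun i => \0 : {linear V i -> W i}) _.
Next Obligation. by rewrite linear0. Qed.

Program Definition mor_add (f g : mor V W) : mor V W :=
  @Mor k C V W (fun i => f i \+ g i : {linear V i -> W i}) _.
Next Obligation. by rewrite !mor_nat linearD. Qed.

Program Definition mor_opp (f : mor V W) : mor V W :=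
  @Mor k C V W (fun i => \- f i : {linear V i -> W i}) _.
Next Obligation. by rewrite !mor_nat linearN. Qed.

Program Definition mor_scale (a : k) (f : mor V W) : mor V W :=
  @Mor k C V W (fun i => a \*: f i : {linear V i -> W i}) _.
Next Obligation. by rewrite !mor_nat linearZ. Qed.

Lemma mor_addA : associative mor_add.
Proof. by move=> f g h; apply: mor_ext => i x /=; rewrite addrA. Qed.
Lemma mor_addC : commutative mor_add.
Proof. by move=> f g; apply: mor_ext => i x /=; rewrite addrC. Qed.
Lemma mor_add0 : left_id mor_zero mor_add.
Proof. by move=> f; apply: mor_ext => i x /=; rewrite add0r. Qed.
Lemma mor_addN : left_inverse mor_zero mor_opp mor_add.
Proof. by move=> f; apply: mor_ext => i x /=; rewrite addNr. Qed.

HB.instance Definition _ :=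
  GRing.isZmodule.Build (mor V W) mor_addA mor_addC mor_add0 mor_addN.

Lemma mor_scaleA a b (f : mor V W) :
  mor_scale a (mor_scale b f) = mor_scale (a * b) f.
Proof. by apply: mor_ext => i x /=; rewrite scalerA. Qed.
Lemma mor_scale1 : left_id 1 mor_scale.
Proof. by move=> f; apply: mor_ext => i x /=; rewrite scale1r. Qed.
Lemma mor_scaleDr : right_distributive mor_scale +%R.
Proof. by move=> a f g; apply: mor_ext => i x /=; rewrite scalerDr. Qed.
Lemma mor_scaleDl f : {morph mor_scale^~ f : a b / a + b}.
Proof. by move=> a b; apply: mor_ext => i x /=; rewrite scalerDl. Qed.

HB.instance Definition _ := GRing.Zmodule_isLmodule.Build k (mor V W)
  mor_scaleA mor_scale1 mor_scaleDr mor_scaleDl.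
End HomModule.

Section DualSpace.
Variables (k : fieldType) (U : lmodType k).

Definition dual_space := {linear U -> k^o}.

HB.instance Definition _ := gen_eqMixin dual_space.
HB.instance Definition _ := gen_choiceMixin dual_space.

Definition dual_zero : dual_space := (\0 : {linear U -> k^o}).
Definition dual_add (f g : dual_space) : dual_space :=
  (f \+ g : {linear U -> k^o}).
Definition dual_opp (f : dual_space) : dual_space := (\- f : {linear U -> k^o}).
Definition dual_scale (a : k) (f : dual_space) : dual_space :=
  (a \*: f : {linear U -> k^o}).

Lemma dual_addA : associative dual_add.
Proof. by move=> f g h; apply: lin_ext => x /=; rewrite addrA. Qed.
Lemma dual_addC : commutative dual_add.
Proof. by move=> f g; apply: lin_ext => x /=; rewrite addrC. Qed.
Lemma dual_add0 : left_id dual_zero dual_add.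
Proof. by move=> f; apply: lin_ext => x /=; rewrite add0r. Qed.
Lemma dual_addN : left_inverse dual_zero dual_opp dual_add.
Proof. by move=> f; apply: lin_ext => x /=; rewrite addNr. Qed.

HB.instance Definition _ :=
  GRing.isZmodule.Build dual_space dual_addA dual_addC dual_add0 dual_addN.

Lemma dual_scaleA a b f : dual_scale a (dual_scale b f) = dual_scale (a * b) f.
Proof. by apply: lin_ext => x /=; rewrite scalerA. Qed.
Lemma dual_scale1 : left_id 1 dual_scale.
Proof. by move=> f; apply: lin_ext => x /=; rewrite scale1r. Qed.
Lemma dual_scaleDr : right_distributive dual_scale +%R.
Proof. by move=> a f g; apply: lin_ext => x /=; rewrite scalerDr. Qed.
Lemma dual_scaleDl f : {morph dual_scale^~ f : a b / a + b}.
Proof. by move=> a b; apply: lin_ext => x /=; rewrite scalerDl. Qed.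

HB.instance Definition _ := GRing.Zmodule_isLmodule.Build k dual_space
  dual_scaleA dual_scale1 dual_scaleDr dual_scaleDl.
End DualSpace.

(* {ffun T -> k^o} is the vector space with basis T; [push h] is the linear
   extension of the map h of bases. *)
Section Push.
Implicit Types S T U : finType.
Variable k : fieldType.

Definition push (S T : finType) (h : S -> T) (a : {ffun S -> k^o}) :
    {ffun T -> k^o} := [ffun t => \sum_(s | h s == t) a s].

Lemma push_linear S T (h : S -> T) : linear (push h).
Proof.
move=> c a b; apply/ffunP => t; rewrite !ffunE scaler_sumr -big_split /=.
by apply: eq_bigr => s _; rewrite !ffunE.
Qed.

Lemma push_id S (h : S -> S) a : h =1 id -> push h a = a.
Proof.
move=> e; apply/ffunP => t; rewrite ffunE (eq_bigl (pred1 t)).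
  by rewrite big_pred1_eq.
by move=> s; rewrite e.
Qed.

Lemma push_comp S T U (g : T -> U) (h : S -> T) a :
  push (g \o h) a = push g (push h a).
Proof.
apply/ffunP => u; rewrite !ffunE (partition_big h (fun t => g t == u)) //=.
apply: eq_bigr => t /eqP <-; rewrite ffunE; apply: eq_bigl => s.
by rewrite /=; case: (h s =P t) => [->|]; rewrite ?eqxx ?andbF.
Qed.

Lemma eq_push S T (g h : S -> T) a : g =1 h -> push g a = push h a.
Proof.
by move=> e; apply/ffunP => u; rewrite !ffunE; apply: eq_bigl => s; rewrite e.
Qed.
End Push.

Section Nakayama.
Variables (k : fieldType) (C : fincat).

(* The left module A e_i, j |-> k C(i, j). *)
Program Definition proj_mod (i : C) : cmodule k C :=
  @CModule k C (fun j => {ffun fhom i j -> k^o} : lmodType k)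
    (fun j l f => mklin (push_linear (fcomp (i := i) f))) _ _.
Next Obligation. by apply: push_id => g; rewrite /= fcomp_idl. Qed.
Next Obligation.
by rewrite -push_comp; apply: eq_push => h; rewrite /= fcomp_assoc.
Qed.

(* Right multiplication by f : i -> j, as a map A e_j -> A e_i. *)
Program Definition proj_mulr (i j : C) (f : fhom i j) :
    mor (proj_mod j) (proj_mod i) :=
  @Mor k C (proj_mod j) (proj_mod i)
    (fun l => mklin (push_linear (fun g : fhom j l => fcomp g f))) _.
Next Obligation.
by rewrite -!push_comp; apply: eq_push => h; rewrite /= fcomp_assoc.
Qed.

(* The right module Hom_C(V, A) = (+)_i Hom_C(V, A e_i); right modules are
   left modules over the opposite category. *)
Section HomA.
Variable V : cmodule k C.

Lemma homA_act_linear (i j : opcat C) (f : fhom i j) :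
  linear (fun h : mor V (proj_mod i) => mor_comp (proj_mulr f) h).
Proof. by move=> a x y; apply: mor_ext => l v; exact: push_linear. Qed.

Program Definition homA : cmodule k (opcat C) :=
  @CModule k (opcat C) (fun i => mor V (proj_mod i) : lmodType k)
    (fun i j f => mklin (@homA_act_linear i j f)) _ _.
Next Obligation.
by apply: mor_ext => l v /=; apply: push_id => g; rewrite /= fcomp_idr.
Qed.
Next Obligation.
apply: mor_ext => m v /=; rewrite -push_comp; apply: eq_push => h.
by rewrite /= fcomp_assoc.
Qed.
End HomA.

Lemma homA_map_linear (V W : cmodule k C) (f : mor V W) (i : opcat C) :
  linear (fun h : mor W (proj_mod i) => mor_comp h f).
Proof. by move=> a x y; apply: mor_ext. Qed.

Program Definition homA_map (V W : cmodule k C) (f : mor V W) :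
    mor (homA W) (homA V) :=
  @Mor k (opcat C) (homA W) (homA V)
    (fun i => mklin (@homA_map_linear V W f i)) _.
Next Obligation. by apply: mor_ext. Qed.

(* D = Hom_k(-, k), from right modules to left modules. *)
Section Dual.
Variable W : cmodule k (opcat C).

Lemma dual_act_linear (i j : C) (f : fhom i j) :
  linear (fun p : dual_space (W i) =>
    (p \o act W (f : @fhom (opcat C) j i) : {linear W j -> k^o})
      : dual_space (W j)).
Proof. by move=> a p q; apply: lin_ext. Qed.

Program Definition dual : cmodule k C :=
  @CModule k C (fun i => dual_space (W i) : lmodType k)
    (fun i j f => mklin (dual_act_linear f)) _ _.
Next Obligation.
by apply: lin_ext => y; congr (x _); apply: (act_id (c := W)).
Qed.
Next Obligation.
by apply: lin_ext => y; congr (x _); apply: (act_comp (c := W)).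
Qed.
End Dual.

Lemma dual_map_linear (V W : cmodule k (opcat C)) (f : mor V W) (i : C) :
  linear (fun p : dual_space (W i) =>
    (p \o f i : {linear V i -> k^o}) : dual_space (V i)).
Proof. by move=> a x y; apply: lin_ext. Qed.

Program Definition dual_map (V W : cmodule k (opcat C)) (f : mor V W) :
    mor (dual W) (dual V) :=
  @Mor k C (dual W) (dual V) (fun i => mklin (@dual_map_linear V W f i)) _.
Next Obligation. by apply: lin_ext => y; rewrite /= mor_nat. Qed.

End Nakayama.

Section FiniteDim.
Variables (k : fieldType).

Lemma emb_span (U : lmodType k) (E : vectType k) (phi : {linear U -> E}) :
    injective phi ->
  exists m (u : 'I_m -> U), forall P : set U, P 0 ->
    (forall a x y, P x -> P y -> P (a *: x + y)) ->
    (forall t, P (u t)) -> forall x, P x.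
Proof.
move=> phi_inj.
pose good (d : nat) := `[< exists2 X : {vspace E}, \dim X = d &
  forall v, v \in X -> exists u, phi u = v >].
have good0 : good 0%N.
  apply/asboolP; exists 0%VS; first by rewrite dimv0.
  by move=> v; rewrite memv0 => /eqP ->; exists 0; rewrite linear0.
have goodM d : good d -> (d <= \dim {:E})%N.
  by move=> /asboolP [X <- _]; apply/dimvS/subvf.
have [d /asboolP [X dX XP] dmax] := ex_maxnP (ex_intro (fun d => good d) 0%N good0) goodM.
have inX u : phi u \in X.
  apply: contraT => uX.
  have gS : good (\dim (X + <[phi u]>)).
    apply/asboolP; exists (X + <[phi u]>)%VS => // v.
    move=> /memv_addP [x xX [w /vlineP [a ->] ->]].
    have [y <-] := XP x xX; exists (y + a *: u).
    by rewrite linearD linearZ.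
  have := dmax _ gS; rewrite -dX => le.
  have /eqP XE : X == (X + <[phi u]>)%VS by rewrite eqEdim addvSl le.
  by rewrite XE in uX; case/negP: uX; apply: subvP (addvSr _ _) _ (memv_line _).
have uP (t : 'I_(\dim X)) : exists u, phi u = (vbasis X)`_t.
  by apply: XP; apply: vbasis_mem; apply: mem_nth; rewrite size_tuple.
exists (\dim X), (fun t => sval (cid (uP t))) => P P0 Plin Pu x.
have -> : x = \sum_t coord (vbasis X) t (phi x) *: sval (cid (uP t)).
  apply: phi_inj; rewrite linear_sum {1}(coord_vbasis (inX x)).
  by apply: eq_bigr => t _; rewrite linearZ; case: cid => y /= ->.
elim/big_ind: _ => //.
  by move=> y z Py Pz; rewrite -[y]scale1r; apply: Plin.
by move=> t _; rewrite -[_ *: _]addr0; apply: Plin.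
Qed.

Lemma finite_set_enum (T : Type) (A : set T) : finite_set A ->
  exists n (c : 'I_n -> T), forall i, A i -> exists t, c t = i.
Proof.
move=> /finite_setP [n /card_set_bijP [f [fI finj fsurj]]].
have cP (t : 'I_n) : exists i, A i /\ f i = t.
  by have [i Ai fi] := fsurj _ (ltn_ord t); exists i.
exists n, (fun t => sval (cid (cP t))) => i Ai.
exists (Ordinal (fI _ Ai)).
case: cid => j /= [Aj fj]; apply: finj => //; exact: mem_set.
Qed.

Lemma fin_dim_locally (C : fincat) (V : cmodule k C) (A : set C) :
    finite_set A -> (forall i, ~ A i -> forall x : V i, x = 0) ->
    (forall i, exists (E : vectType k) (phi : {linear V i -> E}),
       injective phi) ->
  fin_dim V.
Proof.
move=> /finite_set_enum [n [c cP]] A0 Vi.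
have key i : exists m (u : 'I_m -> V i), forall P : set (V i), P 0 ->
    (forall a x y, P x -> P y -> P (a *: x + y)) ->
    (forall t, P (u t)) -> forall x, P x.
  by have [E [phi phi_inj]] := Vi i; exact: emb_span phi_inj.
pose m i := sval (cid (key i)).
pose u i : 'I_(m i) -> V i := sval (cid (svalP (cid (key i)))).
have uP i : forall P : set (V i), P 0 ->
    (forall a x y, P x -> P y -> P (a *: x + y)) ->
    (forall t, P (u i t)) -> forall x, P x.
  exact: svalP (cid (svalP (cid (key i)))).
pose I : finType := {t : 'I_n & 'I_(m (c t))}.
exists #|I|, (fun s => helt (u (c (tag (enum_val s))) (tagged (enum_val s)))).
move=> S S0 Slin Su i x.
have [/cP [t ti]|nA] := pselect (A i); last by rewrite (A0 _ nA x).
subst i; apply: uP; [exact: S0|exact: Slin|move=> r].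
by have := Su (enum_rank (Tagged (fun t => 'I_(m (c t))) r)); rewrite enum_rankK.
Qed.

Lemma homA_fin_dim (C : fincat) (V : cmodule k C) :
  inwards_finite C -> fin_gen V -> fin_dim (homA V).
Proof.
move=> hC [n [g gP]].
pose A : set C := (\bigcup_(t in [set: 'I_n])
  [set i : C | inhabited (fhom i (tag (g t)))])%classic.
have f0P (i : C) (f : mor V (proj_mod k i)) :
    (forall t, f _ (tagged (g t)) = 0) -> f = 0.
  move=> f0; apply: mor_ext => j x; exact: (gP (ker f) f0).
apply: (@fin_dim_locally (opcat C) _ A).
- by apply: bigcup_finite => [|t _]; [exact: finite_finset | exact: hC].
- move=> i nA f; apply: f0P => t; apply/ffunP => p.
  by case: nA; exists t.
move=> i0; pose i : C := i0; pose I : finType := {t : 'I_n & fhom i (tag (g t))}.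
pose phi (f : mor V (proj_mod k i)) : {ffun I -> k^o} :=
  [ffun p => f _ (tagged (g (tag p))) (tagged p)].
have phil : linear phi.
  by move=> a f h; apply/ffunP => p; rewrite !ffunE.
exists {ffun I -> k^o}, (mklin phil) => f h /= efh.
apply/eqP; rewrite -subr_eq0; apply/eqP/f0P => t; apply/ffunP => p.
have /ffunP /(_ (Tagged (fun t => fhom i (tag (g t))) p)) := efh.
by rewrite !ffunE /= => ->; rewrite subrr.
Qed.

Lemma dual_fin_dim (C : fincat) (W : cmodule k (opcat C)) :
  fin_dim W -> fin_dim (dual W).
Proof.
move=> [n [g gP]].
pose u (i : C) (t : 'I_n) : W i := match pselect (tag (g t) = i) with
  | left e => eq_rect _ (fun i => W i : Type) (tagged (g t)) i e
  | right _ => 0 end.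
have p0P i (p : dual_space (W i)) : (forall t, p (u i t) = 0) -> p = 0.
  move=> p0; apply: lin_ext => x.
  pose S (j : C) : set (W j) := fun y =>
    forall e : j = i, p (eq_rect _ (fun i => W i : Type) y i e) = 0.
  apply: (gP S _ _ _ i x erefl).
  - by move=> j e; subst j; rewrite /= linear0.
  - move=> j a y z Sy Sz e; subst j.
    by have := Sy erefl; have := Sz erefl; rewrite /= linearP => -> ->;
      rewrite scaler0 addr0.
  - move=> t e; have := p0 t; rewrite /u; case: pselect => // e'.
    by rewrite (Prop_irrelevance e' e).
apply: (@fin_dim_locally C _ [set i : C | exists t, tag (g t) = i]%classic).
- have -> : ([set i : C | exists t, tag (g t) = i] =
      (fun t => tag (g t) : C) @` [set: 'I_n])%classic.
    by apply/seteqP; split=> i [t]; [exists t | move=> _ <-; exists t].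
  by apply: finite_image; exact: finite_finset.
- move=> i nA p; apply: p0P => t; rewrite /u; case: pselect => [e|_].
    by case: nA; exists t.
  by rewrite linear0.
move=> i; pose phi (p : dual_space (W i)) : {ffun 'I_n -> k^o} :=
  [ffun t => p (u i t)].
have phil : linear phi by move=> a p q; apply/ffunP => t; rewrite !ffunE.
exists {ffun 'I_n -> k^o}, (mklin phil) => p q /= epq.
apply/eqP; rewrite -subr_eq0; apply/eqP/p0P => t.
have /ffunP /(_ t) := epq; rewrite !ffunE => e.
by apply/eqP; rewrite subr_eq0; apply/eqP.
Qed.
End FiniteDim.

Section NakayamaFunctor.
Variables (k : fieldType) (C : fincat).
Hypothesis hC : inwards_finite C.

Lemma nu_fin_dim (V : cmodule k C) : fin_gen V -> fin_dim (dual (homA V)).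
Proof. by move=> fgV; apply/dual_fin_dim/homA_fin_dim. Qed.

Definition nu_ob (V : fgmod k C) : fdmod k C :=
  exist (fun W : fgmod k C => fin_dim (sval W))
    (exist (@fin_gen k C) (dual (homA (sval V)))
       (fin_dim_gen (nu_fin_dim (svalP V))))
    (nu_fin_dim (svalP V)).

Definition nu_map (V W : fgmod k C) (f : hom V W) : hom (nu_ob V) (nu_ob W) :=
  dual_map (homA_map (f : mor (sval V) (sval W))).

Lemma nu_map_id (V : fgmod k C) : nu_map (idm V) = idm (nu_ob V).
Proof.
apply: mor_ext => i p; apply: lin_ext => h.
by congr (p _); apply: mor_ext.
Qed.

Lemma nu_map_comp (U V W : fgmod k C) (g : hom V W) (f : hom U V) :
  nu_map (comp g f) = comp (nu_map g) (nu_map f).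
Proof.
apply: mor_ext => i p; apply: lin_ext => h.
by congr (p _); apply: mor_ext.
Qed.

Definition nu : functor (fgmod k C) (fdmod k C) :=
  @Functor (fgmod k C) (fdmod k C) nu_ob nu_map nu_map_id nu_map_comp.

Definition ker_nu (V : fgmod k C) : Prop :=
  forall i (x : sval (sval (nu V)) i), x = 0.

Definition locally_self_injective : Prop :=
  forall i : C, injective_module (proj_mod k i).

Lemma ker_nuP (V : fgmod k C) :
  ker_nu V <-> forall i (f : mor (sval V) (proj_mod k i)), f = 0.
Proof.
split=> [H i f|H i p]; last first.
  by apply: lin_ext => f; rewrite (H i f) linear0.
apply: mor_ext => j x; apply/ffunP => q.
have evl : linear (fun f : mor (sval V) (proj_mod k i) => f j x q : k^o).
  by move=> a g h; rewrite /= !ffunE.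
have /(congr1 (fun p : dual_space _ => p f)) := H i (mklin evl).
by rewrite /= => ->; rewrite ffunE.
Qed.

Lemma ker_nu_serre : locally_self_injective -> serre ker_nu.
Proof.
move=> hA; split=> [V V0|U V W f g [fi gs ex]].
  by apply/ker_nuP => i f; apply: mor_ext => j x; rewrite (V0 j x) !linear0.
split=> [/ker_nuP HV|[/ker_nuP HU /ker_nuP HW]].
  split; apply/ker_nuP => i p.
    have [h <-] := hA i _ _ _ p fi.
    by rewrite (HV i h); apply: mor_ext.
  apply: mor_ext => j y; have [x <-] := gs j y.
  exact: (congr1 (fun q : mor _ _ => q j x) (HV i (mor_comp p g))).
apply/ker_nuP => i p.
have [|h hE] := @factor_surj _ _ _ _ _ g p gs.
  move=> j y /ex [x <-].
  exact: (congr1 (fun q : mor _ _ => q j x) (HU i (mor_comp p f))).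
by apply: mor_ext => j x; rewrite -hE (HW i h).
Qed.
End NakayamaFunctor.

(* Main.v *)
(* Write A for the category algebra. A morphism X -> Y of the Serre quotient is a
   partial map whose graph has a dense domain and a small indeterminacy. As A e_i
   is injective, it induces a right module map psi : Hom(Y, A) -> Hom(X, A), which
   determines it, and any psi comes from the relation
   {(x, y) | psi h x = h y for all h}; so Hom(-, A) is fully faithful on the
   quotient. It is essentially surjective because it turns the kernel of the map
   of left modules dual to a presentation of a right module M back into M.
   Composing with the duality D gives the equivalence. *)
Require Import Defs.
From mathcomp Require Import all_boot all_order all_algebra.
From mathcomp Require Import boolp classical_sets cardinality.
Import Defs.
Import GRing.Theory.
Local Open Scope ring_scope.

Set Implicit Arguments.
Unset Strict Implicit.
Unset Printing Implicit Defensive.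

(** * Dual bases of finitely spanned vector spaces *)

Section LinearAlgebra.
Variable k : fieldType.
Implicit Types U : lmodType k.

(** Induction on the size of the spanning family: a nontrivial relation lets one vector be dropped;
    without one, coefficients are unique and therefore linear in [x]. *)
Lemma dual_basis U n (u : 'I_n -> U) :
    (forall x, exists c : 'I_n -> k, x = \sum_t c t *: u t) ->
  exists m (v : 'I_m -> U) (c : 'I_m -> dual_space U),
    forall x, x = \sum_t c t x *: v t.
Proof.
elim: n u => [|n IH] u span.
  exists 0%N, u, (fun _ => 0) => x.
  by have [c ->] := span x; rewrite !big_ord0.
have [[c [s cs0 c0]]|free] := pselect
    (exists c : 'I_n.+1 -> k, exists2 s, c s != 0 & \sum_t c t *: u t = 0).
  apply: (IH (fun t => u (lift s t))) => x; have [d ->] := span x.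
  (* Subtracting [d s / c s] times the relation cancels the coefficient of [u s]. *)
  exists (fun t => d (lift s t) - d s / c s * c (lift s t)).
  have : \sum_t (d t - d s / c s * c t) *: u t = \sum_t d t *: u t.
    under eq_bigr do rewrite scalerBl -scalerA.
    by rewrite sumrB -scaler_sumr c0 scaler0 subr0.
  by rewrite (bigD1_ord s) //= divfK // subrr scale0r add0r => <-.
pose c x := sval (cid (span x)).
have cE x : x = \sum_t c x t *: u t by exact: svalP (cid (span x)).
have uniqc x (d : 'I_n.+1 -> k) : x = \sum_t d t *: u t -> forall t, c x t = d t.
  move=> xE t; apply: contrapT => ne; apply: free.
  exists (fun t => c x t - d t), t; first by rewrite subr_eq0; apply/eqP.
  by under eq_bigr do rewrite scalerBl; rewrite sumrB -cE -xE subrr.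
have cl t : linear (fun x => c x t : k^o).
  move=> a x y; apply: (uniqc _ (fun t => a * c x t + c y t)).
  under eq_bigr do rewrite scalerDl -scalerA.
  by rewrite big_split -scaler_sumr -!cE.
by exists n.+1, u, (fun t => mklin (cl t)) => x; exact: cE.
Qed.

Lemma sum_dualE U (I : finType) (F : I -> dual_space U) (x : U) :
  (\sum_t F t : dual_space U) x = \sum_t F t x.
Proof. by elim/big_rec2: _ => // t a b _ <-. Qed.

End LinearAlgebra.

(** * Separation and reflexivity for finite-dimensional modules *)

Section FinDim.
Variables (k : fieldType) (C : fincat).
Implicit Types V W : cmodule k C.

Lemma fin_dim_dual_basis V (i : C) : fin_dim V ->
  exists m (v : 'I_m -> V i) (c : 'I_m -> dual_space (V i)),
    forall x, x = \sum_t c t x *: v t.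
Proof.
move=> [n [g gP]].
pose u (t : 'I_n) : V i := match pselect (tag (g t) = i) with
  | left e => eq_rect _ (fun i => V i : Type) (tagged (g t)) i e
  | right _ => 0 end.
apply: (@dual_basis _ _ n u) => x.
(* [fin_dim] needs a family of subspaces over all objects; quantifying over [e] makes the condition
   vacuous away from [i]. *)
pose S (j : C) : set (V j) := fun y => forall e : j = i,
  exists c : 'I_n -> k, eq_rect _ (fun i => V i : Type) y i e = \sum_t c t *: u t.
apply: (gP S _ _ _ i x erefl).
- move=> j e; subst j; exists (fun _ => 0).
  by rewrite big1 // => t _; rewrite scale0r.
- move=> j a y z Sy Sz e; subst j.
  have [c /= ->] := Sy erefl; have [d /= ->] := Sz erefl.
  exists (fun t => a * c t + d t); rewrite scaler_sumr -big_split /=.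
  by apply: eq_bigr => t _; rewrite scalerDl scalerA.
- move=> t e; exists (fun s => (s == t)%:R).
  rewrite (bigD1 t) //= eqxx scale1r big1 ?addr0; last first.
    by move=> s /negPf ->; rewrite scale0r.
  by rewrite /u; case: pselect => // e'; rewrite (Prop_irrelevance e' e).
Qed.

Lemma fin_dim_separated V (i : C) (x : V i) :
  fin_dim V -> (forall p : dual_space (V i), p x = 0) -> x = 0.
Proof.
move=> /(@fin_dim_dual_basis _ i) [m [v [c cE]]] p0.
by rewrite (cE x) big1 // => t _; rewrite p0 scale0r.
Qed.

(** In a dual basis, [p] is the combination of the [c t] with coefficients [p (v t)], so [phi] is
    determined by the scalars [phi (c t)], which serve as coordinates of [x]. *)
Lemma fin_dim_reflexive V (i : C) (phi : dual_space (dual_space (V i))) :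
  fin_dim V -> exists x : V i, forall p : dual_space (V i), phi p = p x.
Proof.
move=> /(@fin_dim_dual_basis _ i) [m [v [c cE]]].
exists (\sum_t phi (c t) *: v t) => p.
have pE : p = \sum_t (p (v t) : k) *: c t :> dual_space (V i).
  apply: lin_ext => x; rewrite sum_dualE [in LHS](cE x) linear_sum.
  by apply: eq_bigr => t _; rewrite linearZ; exact: mulrC.
rewrite [in LHS]pE !linear_sum; apply: eq_bigr => t _.
by rewrite !linearZ; exact: mulrC.
Qed.
End FinDim.

Lemma push_sum (k : fieldType) (U : lmodType k) (S T : finType) (h : S -> T)
    (a : {ffun S -> k^o}) (F : T -> U) :
  \sum_t (push h a t : k) *: F t = \sum_s (a s : k) *: F (h s).
Proof.
rewrite [RHS](partition_big h xpredT) //=; apply: eq_bigr => t _.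
by rewrite ffunE scaler_suml; apply: eq_bigr => s /eqP ->.
Qed.

(** * Maps into injective modules *)

Section Factorization.
Variables (k : fieldType) (C : fincat).
Implicit Types X Y Z E : cmodule k C.

(** Both maps descend to the quotient of [X] by the kernel of [f], where [f] becomes injective and
    injectivity of [E] applies. *)
Lemma injective_factor X Z E (f : mor X Z) (q : mor X E) :
    injective_module E -> (forall i x, f i x = 0 -> q i x = 0) ->
  exists r : mor Z E, mor_comp r f = q.
Proof.
move=> injE fq.
have [|f' f'E] := @factor_surj _ _ _ _ _ (quot_proj (ker f)) f
  (@quot_proj_surj _ _ _ _).
  by move=> i x /quot_projE.
have [|q' q'E] := @factor_surj _ _ _ _ _ (quot_proj (ker f)) q
  (@quot_proj_surj _ _ _ _).
  by move=> i x /quot_projE /fq.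
have f'inj : mor_inj f'.
  move=> i u v; have [x <-] := quot_proj_surj u.
  have [y <-] := quot_proj_surj v; rewrite !f'E => e; apply/qpiE.
  by rewrite /ker /= linearB e subrr.
have [r rE] := injE _ _ _ q' f'inj; exists r; apply: mor_ext => i x.
by rewrite -q'E -rE /= f'E.
Qed.

Lemma mor_sumE X Y (I : finType) (F : I -> mor X Y) (i : C) (x : X i) :
  (\sum_t F t) i x = \sum_t F t i x.
Proof. by elim/big_rec2: _ => // t a b _ <-. Qed.
End Factorization.

(** * Finite sums of modules A e_i, as coproducts ([free_lift]) and as products ([free_tuple]) *)

Section Free.
Variables (k : fieldType) (C : fincat) (n : nat) (c : 'I_n -> C).

Definition free_idx (j : C) : finType := {t : 'I_n & fhom (c t) j}.

Definition free_in (j : C) (t : 'I_n) (g : fhom (c t) j) : free_idx j :=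
  Tagged (fun t => fhom (c t) j) g.

Definition free_act (j l : C) (f : fhom j l) (s : free_idx j) : free_idx l :=
  free_in (fcomp f (tagged s)).

(* The left module (+)_t A e_(c t). *)
Program Definition free_mod : cmodule k C :=
  @CModule k C (fun j => {ffun free_idx j -> k^o} : lmodType k)
    (fun j l f => mklin (push_linear (free_act f))) _ _.
Next Obligation.
by apply: push_id => -[t g]; rewrite /free_act /= fcomp_idl.
Qed.
Next Obligation.
by rewrite -push_comp; apply: eq_push => -[t h]; rewrite /free_act /= fcomp_assoc.
Qed.

Definition free_delta (j : C) (s : free_idx j) : free_mod j :=
  [ffun s' => (s' == s)%:R].

Lemma free_delta_sum (j : C) (p : free_mod j) :
  p = \sum_s (p s : k) *: free_delta s.
Proof.
apply/ffunP => s; rewrite sum_ffunE (bigD1 s) //= !ffunE eqxx.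
rewrite big1 ?addr0 => [|s' /negPf ne]; first by rewrite /GRing.scale /= mulr1.
by rewrite !ffunE eq_sym ne scaler0.
Qed.

Lemma push_delta (S T : finType) (h : S -> T) (s : S) :
  push h [ffun s' => (s' == s)%:R] = [ffun t => (t == h s)%:R] :> {ffun T -> k^o}.
Proof.
apply/ffunP => t; rewrite !ffunE (big_mkcond (fun s => h s == t)) (bigD1 s) //=.
rewrite big1 ?addr0 => [|s' /negPf ne]; last by rewrite ffunE ne if_same.
by rewrite ffunE eqxx eq_sym; case: eqP.
Qed.

Lemma free_delta_act (j : C) (s : free_idx j) :
  free_delta s = act free_mod (tagged s) (free_delta (free_in (fid (c (tag s))))).
Proof.
by rewrite /= push_delta; case: s => t g; rewrite /free_act /= fcomp_idr.
Qed.

Section Lift.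
Variables (V : cmodule k C) (v : forall t, V (c t)).

(** By Yoneda a map out of the sum is a choice of images [v t] of the identities of the [c t];
    [free_liftE] is the uniqueness. *)
Definition free_lift_fun (j : C) (p : free_mod j) : V j :=
  \sum_s (p s : k) *: act V (tagged s) (v (tag s)).

Lemma free_lift_linear (j : C) : linear (@free_lift_fun j).
Proof.
move=> a p q; rewrite /free_lift_fun scaler_sumr -big_split /=.
by apply: eq_bigr => s _; rewrite !ffunE scalerDl scalerA.
Qed.

Program Definition free_lift : mor free_mod V :=
  @Mor k C free_mod V (fun j => mklin (@free_lift_linear j)) _.
Next Obligation.
rewrite /free_lift_fun push_sum linear_sum; apply: eq_bigr => s _.
by rewrite linearZ -act_comp.
Qed.

Lemma free_lift_delta (j : C) (s : free_idx j) :
  free_lift j (free_delta s) = act V (tagged s) (v (tag s)).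
Proof.
rewrite /= /free_lift_fun (bigD1 s) //= ffunE eqxx scale1r big1 ?addr0 //.
by move=> s' /negPf ne; rewrite ffunE ne scale0r.
Qed.

Lemma free_lift_in (t : 'I_n) :
  free_lift _ (free_delta (free_in (fid (c t)))) = v t.
Proof. by rewrite free_lift_delta act_id. Qed.
End Lift.

Lemma free_lift_map (V W : cmodule k C) (f : mor V W) (v : forall t, V (c t))
    (j : C) (p : free_mod j) :
  f j (free_lift v j p) = free_lift (fun t => f (c t) (v t)) j p.
Proof.
rewrite /= linear_sum; apply: eq_bigr => s _.
by rewrite linearZ mor_nat.
Qed.

Lemma free_liftE (V : cmodule k C) (f : mor free_mod V) :
  f = free_lift (fun t => f _ (free_delta (free_in (fid (c t))))).
Proof.
apply: mor_ext => j p; rewrite {1}(free_delta_sum p) linear_sum.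
by apply: eq_bigr => s _; rewrite linearZ {1}free_delta_act mor_nat.
Qed.

Lemma fin_gen_free : fin_gen free_mod.
Proof.
exists n, (fun t => helt (free_delta (free_in (fid (c t))))) => S HS j p.
rewrite (free_delta_sum p); elim/big_rec: _ => [|s x _ Sx]; first exact: submod0.
by apply: submodP => //; rewrite free_delta_act; apply/submod_act/HS.
Qed.

(** [free_act f] preserves the summand index, so the fibre over an element of summand [t] stays in
    summand [t]. *)
Lemma free_act_sum (j l : C) (f : fhom j l) (F : free_idx j -> k^o) t
    (g : fhom (c t) l) :
  \sum_(s | free_act f s == free_in g) F s =
  \sum_(g' | fcomp f g' == g) F (free_in g').
Proof.
pose P (t' : 'I_n) (g' : fhom (c t') j) := free_in (fcomp f g') == free_in g.
transitivity (\sum_t' \sum_(g' | @P t' g') F (free_in g')).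
  by rewrite sig_big_dep; apply: eq_big => -[].
rewrite (bigD1 t) //= [X in _ + X]big1 ?addr0 => [|t' ne]; last first.
  by apply: big_pred0 => g'; apply: contraNF ne => /eqP /(congr1 tag) /= ->.
by apply: eq_bigl => g'; rewrite /P /free_in eq_Tagged.
Qed.

Program Definition free_proj (t : 'I_n) : mor free_mod (proj_mod k (c t)) :=
  @Mor k C free_mod (proj_mod k (c t))
    (fun j => @mklin k (free_mod j) (proj_mod k (c t) j)
       (fun p => [ffun g => p (free_in g)]) _) _.
Next Obligation. by move=> a p q; apply/ffunP => g; rewrite !ffunE. Qed.
Next Obligation.
apply/ffunP => g; rewrite !ffunE free_act_sum.
by apply: eq_bigr => g' _; rewrite ffunE.
Qed.

Section Tuple.
Variables (X : cmodule k C) (h : forall t, mor X (proj_mod k (c t))).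

Program Definition free_tuple : mor X free_mod :=
  @Mor k C X free_mod
    (fun j => @mklin k (X j) (free_mod j)
       (fun x => [ffun s => h (tag s) j x (tagged s)]) _) _.
Next Obligation.
by move=> a p q; apply/ffunP => g; rewrite !ffunE linearP !ffunE.
Qed.
Next Obligation.
apply/ffunP => -[t g]; rewrite !ffunE free_act_sum mor_nat ffunE.
by apply: eq_bigr => g' _; rewrite ffunE.
Qed.
End Tuple.

Lemma free_proj_tuple X (h : forall t, mor X (proj_mod k (c t))) t :
  mor_comp (free_proj t) (free_tuple h) = h t.
Proof. by apply: mor_ext => j x; apply/ffunP => g; rewrite !ffunE. Qed.

Lemma free_tuple_inj X Y (h : forall t, mor X (proj_mod k (c t)))
    (h' : forall t, mor Y (proj_mod k (c t))) j x y :
  free_tuple h j x = free_tuple h' j y -> forall t, h t j x = h' t j y.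
Proof.
move=> e t; rewrite -(free_proj_tuple h) -(free_proj_tuple h').
exact: congr1 _ e.
Qed.
End Free.

(** * Columns over A as elements of free right modules *)

Section Transpose.
Variables (k : fieldType) (C : fincat) (n : nat) (c : 'I_n -> C).

(* Every [mor (free_mod k c) (proj_mod k i)] is right multiplication by a column
   of elements of A, that is, by an element of the free right module. *)
Lemma free_tuple_comp (i : C) (r : mor (free_mod k c) (proj_mod k i)) :
  exists rho : free_mod k (C := opcat C) c i,
    forall (X : cmodule k C) (h : forall t, mor X (proj_mod k (c t))),
      mor_comp r (free_tuple h) = free_lift (V := homA X) h i rho.
Proof.
pose a t : proj_mod k i (c t) :=
  r _ (free_delta k (free_in (c := c) (fid (c t)))).
exists [ffun s => a (tag s) (tagged s)] => X h.
apply: mor_ext => j x; rewrite [r]free_liftE mor_sumE.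
apply/ffunP => f; rewrite !sum_ffunE.
under eq_bigr do rewrite !ffunE.
under [RHS]eq_bigr do rewrite !ffunE.
pose F t (g : fhom (c t) j) (q : fhom i (c t)) : k := h t j x g * a t q.
(* Both coefficients at [f] sum over the factorizations of [f] as [g] after [q]; one side groups
   them by [g], the other by [q]. *)
transitivity (\sum_t \sum_g \sum_(q | fcomp g q == f) F t g q).
  rewrite (sig_big_dep _ _ (fun t g => \sum_(q | fcomp g q == f) F t g q)) /=.
  by apply: eq_bigr => -[t g] _ /=; rewrite scaler_sumr.
transitivity (\sum_t \sum_q \sum_(g | fcomp g q == f) F t g q).
  by apply: eq_bigr => t _; rewrite (exchange_big_dep xpredT).
rewrite (sig_big_dep _ _ (fun t q => \sum_(g | fcomp g q == f) F t g q)) /=.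
apply: eq_bigr => -[t q] _ /=; rewrite scaler_sumr; apply: eq_bigr => g _.
exact: mulrC.
Qed.

(** Right multiplication by the column [rho] sends the [t]-th generator to the [t]-th entry, so
    evaluation at generators recovers [rho]. *)
Lemma free_lift_proj_inj (i : C) (rho : free_mod k (C := opcat C) c i) :
  free_lift (V := homA (free_mod k c)) (free_proj k c) i rho = 0 -> rho = 0.
Proof.
move=> r0; apply/ffunP => -[t q]; rewrite ffunE.
have : (free_lift (V := homA (free_mod k c)) (free_proj k c) i rho : mor _ _) _
    (free_delta k (free_in (c := c) (fid (c t)))) q = 0 by rewrite r0 ffunE.
pose s0 := free_in (C := opcat C) (c := c) (q : fhom i (c t)).
rewrite /= mor_sumE sum_ffunE (bigD1 s0) //= [X in _ + X]big1
  => [|[t' q'] ne].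
  rewrite addr0 !ffunE (bigD1 (fid (c t))) ?fcomp_idl //= big1
    => [|g /andP[_ /negPf ne]].
    by rewrite !ffunE eqxx addr0 => <-; rewrite /GRing.scale /= mulr1.
  by rewrite !ffunE /free_in eq_Tagged /= ne.
rewrite !ffunE big1 ?scaler0 //= => g /eqP gq; rewrite !ffunE.
case: eqP => // e; have tt' : t' = t := congr1 tag e; subst t'.
move/eqP: e; rewrite /free_in eq_Tagged /= => /eqP ge; subst g.
by case/eqP: ne; rewrite /s0 -gq fcomp_idl.
Qed.
End Transpose.

(** * Morphisms of the quotient as maps between the modules Hom(-, A) *)

Section Fractions.
Variables (k : fieldType) (C : fincat).
Hypotheses (hin : inwards_finite C) (hnoeth : locally_noetherian k C).
Hypothesis hinj : locally_self_injective k C.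
Implicit Types X Y Z : fgmod k C.

Let hS : serre (ker_nu (k := k) hin) := ker_nu_serre hin hinj.

(** The difference factors through X/A, which is in [ker_nu] and so has no nonzero map to A e_i. *)
Lemma dense_ext X (A : submod (sval X)) i (f g : mor (sval X) (proj_mod k i)) :
  dense (ker_nu hin) A -> (forall j x, A j x -> f j x = g j x) -> f = g.
Proof.
move=> /(ker_nuP hin) dA fg; apply/eqP; rewrite -subr_eq0; apply/eqP.
have [|d dE] := @factor_surj _ _ _ _ _ (quot_proj A) (f - g)
  (@quot_proj_surj _ _ _ _).
  by move=> j x /quot_projE /fg /= ->; rewrite subrr.
by apply: mor_ext => j x; rewrite -dE (dA _ d).
Qed.

Lemma small_vanish Y (B : submod (sval Y)) i (h : mor (sval Y) (proj_mod k i))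
    j y :
  small hnoeth (ker_nu hin) B -> B j y -> h j y = 0.
Proof.
move=> /(ker_nuP hin) sB By; have [u <-] := sub_incl_onto By.
exact: (congr1 (fun q : mor _ _ => q j u) (sB i (mor_comp h (sub_incl B)))).
Qed.

(** The largest small submodule: it contains every small one by [small_vanish] and is small by
    [small_torsion]. *)
Program Definition torsion Y : submod (sval Y) :=
  @Submod k C (sval Y)
    (fun j y => forall i (h : mor (sval Y) (proj_mod k i)), h j y = 0) _ _ _.
Next Obligation. by rewrite linear0. Qed.
Next Obligation. by rewrite linearP H H0 scaler0 addr0. Qed.
Next Obligation. by rewrite mor_nat H linear0. Qed.

(** By injectivity a map from the torsion to A e_i extends to [Y], and maps on [Y] vanish on the
    torsion. *)
Lemma small_torsion Y : small hnoeth (ker_nu hin) (torsion Y).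
Proof.
apply/(ker_nuP hin) => i f.
have [h <-] := hinj (i := i) f (@sub_incl_inj _ _ _ (torsion Y)).
by apply: mor_ext => j x; exact: (@sub_inclP _ _ _ (torsion Y) j x).
Qed.

(* [psi] sends h to the unique extension to X of the composite of h with the
   partial map of which G is the graph. *)
Definition transports X Y (G : submod (dsum (sval X) (sval Y)))
    (psi : mor (homA (sval Y)) (homA (sval X))) : Prop :=
  forall i (h : mor (sval Y) (proj_mod k i)) j x y,
    G j (x, y) -> (psi i h : mor _ _) j x = h j y.

Notation sfrac := (frac hnoeth (ker_nu hin)).

Lemma transports_uniq X Y (F : sfrac X Y) psi psi' :
  transports (graph F) psi -> transports (graph F) psi' -> psi = psi'.
Proof.
move=> H H'; apply: mor_ext => i h; apply: (dense_ext (dense_dom F)).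
by move=> j x [y Fxy]; rewrite (H _ _ _ _ _ Fxy) (H' _ _ _ _ _ Fxy).
Qed.

(** The graph projects to [X] with kernel the pairs (0, y), where y is in the small indeterminacy
    and is killed by [h]; thus [injective_factor] applies. *)
Lemma frac_extend X Y (F : sfrac X Y) i (h : mor (sval Y) (proj_mod k i)) :
  exists g : mor (sval X) (proj_mod k i),
    forall j x y, graph F j (x, y) -> g j x = h j y.
Proof.
pose G := graph F.
have [|g gE] := @injective_factor _ _ _ _ _
    (mor_comp (dsum_fst _ _) (sub_incl G))
    (mor_comp h (mor_comp (dsum_snd _ _) (sub_incl G))) (hinj (i := i)).
  move=> j u /= u0; apply: (small_vanish h (small_indet F)).
  have := @sub_inclP _ _ _ G j u.
  by rewrite /= [X in G j X]surjective_pairing u0.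
exists g => j x y Fxy; have [u uE] := sub_incl_onto (S := G) Fxy.
have := congr1 (fun q : mor _ _ => q j u) gE.
by rewrite /= -[val u]/(sub_incl G j u) uE.
Qed.

(** [psi h] and the extension of [h] along [G] agree on the dense [A], because [h] vanishes on the
    small [B]. *)
Lemma transports_eq X Y (F G : sfrac X Y) psi :
  frac_eq F G -> transports (graph F) psi -> transports (graph G) psi.
Proof.
move=> [A [B [[dA AF AG] [[sB FB GB] FG]]]] H i h j x0 y0 Gxy0.
have [g gE] := frac_extend G h.
rewrite -(gE _ _ _ Gxy0); congr (mfun _ _ _); apply: (dense_ext dA) => l x Ax.
have [[y Fy] [y' Gy']] := (AF _ _ Ax, AG _ _ Ax).
rewrite (H _ _ _ _ _ Fy) (gE _ _ _ Gy'); apply/eqP; rewrite -subr_eq0 -linearB.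
by rewrite (small_vanish h sB) //; exact: FG Fy Gy'.
Qed.

(** Extensions are chosen one by one; linearity and naturality follow from their uniqueness on the
    dense domain. *)
Lemma transports_exists X Y (F : sfrac X Y) :
  exists psi, transports (graph F) psi.
Proof.
pose p i h := sval (cid (frac_extend F (i := i) h)).
have pE i h j x y : graph F j (x, y) -> p i h j x = h j y.
  by rewrite /p; case: cid => g /= gE /gE.
have pl i : linear (p i).
  move=> a f g; apply: (dense_ext (dense_dom F)) => j x [y Fxy].
  by rewrite /= !(pE _ _ _ _ _ Fxy).
have pn (i j : opcat C) (f : fhom i j) h :
    mklin (U := homA (sval Y) j) (V := homA (sval X) j) (pl j)
      (act (homA (sval Y)) f h) = act (homA (sval X)) f (mklin (pl i) h).
  apply: (dense_ext (dense_dom F)) => l x [y Fxy].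
  by rewrite /= !(pE _ _ _ _ _ Fxy).
exists (@Mor k (opcat C) (homA (sval Y)) (homA (sval X))
  (fun i => mklin (pl i)) pn).
move=> i h j x y; exact: pE.
Qed.

(** No [h] distinguishes values of [F] and [G] at the same point, so they differ by torsion. *)
Lemma transports_frac_eq X Y (F G : sfrac X Y) psi :
  transports (graph F) psi -> transports (graph G) psi -> frac_eq F G.
Proof.
move=> HF HG; exists (cap (dom (graph F)) (dom (graph G))), (torsion Y).
split; [|split].
- split=> [|i x []//|i x []//].
  by apply: (dense_cap hnoeth hS); exact: dense_dom.
- split; first exact: small_torsion.
  + by move=> j y Fy i h; exact: (small_vanish h (small_indet F)).
  + by move=> j y Gy i h; exact: (small_vanish h (small_indet G)).
- move=> j x y y' _ Fy Gy' i h.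
  by rewrite linearB -(HF _ _ _ _ _ Fy) -(HG _ _ _ _ _ Gy') subrr.
Qed.

Section Full.
Variables (X Y : fgmod k C) (psi : mor (homA (sval Y)) (homA (sval X))).

Program Definition transport_graph : submod (dsum (sval X) (sval Y)) :=
  @Submod k C (dsum (sval X) (sval Y))
    (fun j p => forall i (h : mor (sval Y) (proj_mod k i)),
       (psi i h : mor _ _) j p.1 = h j p.2) _ _ _.
Next Obligation. by rewrite !linear0. Qed.
Next Obligation. by rewrite !linearP H H0. Qed.
Next Obligation. by rewrite !mor_nat H. Qed.

Lemma small_transport_graph : small hnoeth (ker_nu hin) (indet transport_graph).
Proof.
apply: (small_le hS (B := torsion Y)); last exact: small_torsion.
by move=> j y H i h; rewrite -(H i h) /= linear0.
Qed.

(* Let the h_t generate Hom(Y, A) and P be the sum of their targets. The domain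
   consists of the x with (psi h_t x)_t in the image of (h_t)_t : Y -> P, so a map
   X -> A e_i vanishing on it extends along X -> P / im Y; the extension is a
   column of elements of A killing (h_t)_t, hence killing (psi h_t)_t. *)
Lemma dense_transport_graph : dense (ker_nu hin) (dom transport_graph).
Proof.
apply/(ker_nuP hin) => i q0.
pose q := mor_comp q0 (quot_proj (dom transport_graph)).
suff q00 : q = 0.
  apply: mor_ext => j u; have [x <-] := quot_proj_surj u.
  exact: (congr1 (fun q : mor _ _ => q j x) q00).
have [n [g gP]] := fin_dim_gen (homA_fin_dim hin (svalP Y)).
pose c (t : 'I_n) : C := tag (g t).
pose h (t : 'I_n) : mor (sval Y) (proj_mod k (c t)) := tagged (g t).
pose beta := free_tuple h.
pose alpha := free_tuple (fun t => psi _ (h t) : mor (sval X) (proj_mod k (c t))).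
pose B := image beta (fullm (sval Y)).
have [|r rE] := @injective_factor _ _ _ _ _ (mor_comp (quot_proj B) alpha) q
  (hinj (i := i)).
  move=> j x /quot_projE [y _ bE]; rewrite /q /=.
  suff /quot_projE : dom transport_graph j x by move=> /= ->; rewrite linear0.
  exists y.
  (* The maps [f] with [psi f x = f y] form a right submodule; it suffices that it contains the
     generators. *)
  pose T (l : opcat C) (f : homA (sval Y) l) :=
    (psi l f : mor _ _) j x = (f : mor _ _) j y.
  have T0 l : T l 0 by rewrite /T !linear0.
  have TP l a f f' : T l f -> T l f' -> T l (a *: f + f').
    by rewrite /T linearP /= => -> ->.
  have Tact (l m : opcat C) (p : fhom l m) f : T l f -> T m (act _ p f).
    by rewrite /T mor_nat /= => ->.
  move=> l f; apply: (gP (Submod T0 TP Tact)) => t.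
  exact/esym/(free_tuple_inj bE).
pose s := mor_comp r (quot_proj B).
have [rho rhoE] := free_tuple_comp s.
have s0 : mor_comp s beta = 0.
  apply: mor_ext => j y; have /quot_projE e : B j (beta j y) by exists y.
  exact: etrans (congr1 (r j) e) (linear0 (r j)).
rewrite -rE; transitivity (mor_comp s alpha); first exact: mor_ext.
rewrite rhoE.
rewrite rhoE in s0.
(* As [psi] is right linear, the combination [rho] of the [psi h_t] is [psi] of that of the [h_t],
   which is zero. *)
exact: etrans (esym (free_lift_map psi h rho))
  (etrans (congr1 (psi i) s0) (linear0 (psi i))).
Qed.

Definition transport_frac : sfrac X Y :=
  Frac dense_transport_graph small_transport_graph.

Lemma transport_fracP : transports (graph transport_frac) psi.
Proof. by move=> i h j x y; apply. Qed.
End Full.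
End Fractions.

(** * Essential surjectivity of Hom(-, A) *)

Section Presentation.
Variables (k : fieldType) (C : fincat).
Hypotheses (hin : inwards_finite C) (hnoeth : locally_noetherian k C).
Hypothesis hinj : locally_self_injective k C.

(** Inwards finiteness makes free right modules finite-dimensional, so presentations of right
    modules have finitely many relations. *)
Lemma fin_gen_sub_free_op n (c : 'I_n -> C)
    (K : submod (free_mod k (C := opcat C) c)) :
  fin_gen (subm K).
Proof.
apply: fin_dim_gen; pose A : set C := (\bigcup_(t in [set: 'I_n])
  [set i : C | inhabited (fhom i (c t))])%classic.
apply: (@fin_dim_locally k (opcat C) _ A).
- by apply: bigcup_finite => [|t _]; [exact: finite_finset | exact: hin].
- move=> i nA x; apply: (@sub_incl_inj _ _ _ K i); apply/ffunP => -[t g].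
  by case: nA; exists t => //; exists.
- move=> i; exists {ffun free_idx (C := opcat C) c i -> k^o}, (sub_incl K i).
  exact: sub_incl_inj.
Qed.

(* Dualizing a presentation of M by the right modules e_i A gives a map P -> Q
   between sums of modules A e_i; by injectivity Hom(-, A) turns its kernel back
   into M. *)
Lemma homA_ess_surj (M : cmodule k (opcat C)) : fin_dim M ->
  exists (V : fgmod k C) (f : mor M (homA (sval V))), mor_inj f /\ mor_surj f.
Proof.
move=> /fin_dim_gen [n [g gP]].
pose c (t : 'I_n) : C := tag (g t).
pose F0 := free_mod k (C := opcat C) c; pose P := free_mod k c.
pose mu : mor F0 M :=
  free_lift (C := opcat C) (V := M) (c := c) (fun t => tagged (g t)).
(* [theta] identifies the free right module [F0] with Hom(P, A): it is injective by
   [free_lift_proj_inj] and surjective by [theta_surj]. *)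
pose theta : mor F0 (homA P) :=
  free_lift (C := opcat C) (V := homA P) (free_proj k c).
have mu_surj : mor_surj mu.
  move=> i y; have := gP (image mu (fullm F0)) _ i y.
  case=> [t|x _ <-]; last by exists x.
  exists (free_delta k (free_in (C := opcat C) (c := c) (fid (c t)))) => //.
  exact: (free_lift_in (C := opcat C)).
have theta_surj i (r : mor P (proj_mod k i)) : exists rho, theta i rho = r.
  have [rho rhoE] := free_tuple_comp r; exists rho.
  apply: etrans (esym (rhoE _ (free_proj k c))) _; apply: mor_ext => j p.
  by apply: (congr1 (r j)); apply/ffunP => -[t q]; rewrite !ffunE.
have [m [rel relP]] := fin_gen_sub_free_op (ker mu).
pose b (s : 'I_m) : C := tag (rel s).
pose rho (s : 'I_m) : F0 (b s) := sub_incl (ker mu) _ (tagged (rel s)).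
have mu_rho s : mu _ (rho s) = 0 by exact: (@sub_inclP _ _ _ (ker mu)).
(* The relations, read as maps on [P], are the components of the dual presentation
   [free_tuple r]. *)
pose r (s : 'I_m) : mor P (proj_mod k (b s)) := theta _ (rho s).
pose K := ker (free_tuple r).
pose V := exist _ (subm K) (hnoeth (fin_gen_free k c) K) : fgmod k C.
pose thetaV : mor F0 (homA (subm K)) := mor_comp (homA_map (sub_incl K)) theta.
have muV i x : mu i x = 0 -> thetaV i x = 0.
  move=> mux; have [u <-] := sub_incl_onto (S := ker mu) mux.
  apply: (relP (ker (mor_comp thetaV (sub_incl (ker mu))))) => s.
  apply: mor_ext => j v /=.
  have := @sub_inclP _ _ _ K j v; rewrite /K /ker /= => v0.
  transitivity (r s j (sub_incl K j v)) => //.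
  rewrite -(free_proj_tuple r).
  exact: etrans (congr1 (free_proj k b s j) v0) (linear0 _).
(* If [theta x] vanishes on [K], it factors through [free_tuple r] by a column [sig]; then [x] is
   the combination [sig] of the relations, which [mu] kills. *)
have Vmu i x : thetaV i x = 0 -> mu i x = 0.
  move=> x0.
  have [|q qE] := @injective_factor _ _ _ _ _ (free_tuple r) (theta i x : mor _ _)
      (hinj (i := i)).
    move=> j p pK; have [v <-] := sub_incl_onto (S := K) pK.
    exact: (congr1 (fun f : mor _ _ => f j v) x0).
  have [sig sigE] := free_tuple_comp q.
  have xE : x = free_lift (C := opcat C) (V := F0) (c := b) rho i sig.
    apply/eqP; rewrite -subr_eq0; apply/eqP/free_lift_proj_inj.
    rewrite linearB -/theta; apply/eqP; rewrite subr_eq0; apply/eqP.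
    by rewrite -[LHS]qE sigE free_lift_map.
  rewrite xE free_lift_map; apply: big1 => s _.
  have e : act M (tagged s) (mu _ (rho (tag s))) = 0 by rewrite mu_rho linear0.
  by apply: etrans (congr1 _ e) _; exact: scaler0.
have [f fE] := factor_surj mu_surj muV.
exists V, f; split=> i.
  move=> y y'; have [x <-] := mu_surj i y; have [x' <-] := mu_surj i y'.
  rewrite !fE => e; apply/eqP; rewrite -subr_eq0 -linearB; apply/eqP/Vmu.
  by rewrite linearB e subrr.
(* A map on [K] extends to [P] by injectivity, and every map on [P] is some [theta x]. *)
move=> h; have [r' r'E] := hinj (i := i) h (@sub_incl_inj _ _ _ K).
have [x xE] := theta_surj i r'; exists (mu i x).
by rewrite fE -r'E -xE.
Qed.
End Presentation.

(** * Fully faithful, essentially surjective functors *)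

Section Categories.

Lemma functor_ext (A B : category) (o : A -> B)
    (m m' : forall x y : A, hom x y -> hom (o x) (o y)) mi mi' mc mc' :
  (forall x y f, m x y f = m' x y f) ->
  @Functor A B o m mi mc = @Functor A B o m' mi' mc'.
Proof.
move=> e; have {}e : m = m'.
  by do 3![apply: functional_extensionality_dep => ?].
by subst m'; rewrite (Prop_irrelevance mi mi') (Prop_irrelevance mc mc').
Qed.

Lemma is_iso_comp (A : category) (x y z : A) (g : hom y z) (f : hom x y) :
  is_iso g -> is_iso f -> is_iso (comp g f).
Proof.
move=> [g' [g'g gg']] [f' [f'f ff']]; exists (comp f' g'); split.
  by rewrite -comp_assoc (comp_assoc g') g'g comp_idl.
by rewrite -comp_assoc (comp_assoc f) ff' comp_idl.
Qed.

(** The quasi-inverse conjugates by chosen isomorphisms [e b] and lifts through [F]; faithfulness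
    gives its laws. The [e b] are the counit, the lifts of [e (F x)] the unit. *)
Lemma fully_faithful_equivalence (A B : category) (F : functor A B) :
    (forall x y (g : hom (F x) (F y)), exists f, fmap F f = g) ->
    (forall x y (f g : hom x y), fmap F f = fmap F g -> f = g) ->
    (forall b, exists a (e : hom (F a) b), is_iso e) ->
  is_equivalence F.
Proof.
move=> full faithful ess.
pose o b := sval (cid (ess b)).
pose e b : hom (F (o b)) b := sval (cid (svalP (cid (ess b)))).
have eI b : is_iso (e b) by exact: svalP (cid (svalP (cid (ess b)))).
pose e' b := sval (cid (eI b)).
have e'e b : comp (e' b) (e b) = idm _ by exact: (svalP (cid (eI b))).1.
have ee' b : comp (e b) (e' b) = idm _ by exact: (svalP (cid (eI b))).2.
pose lift x y (g : hom (F x) (F y)) := sval (cid (full x y g)).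
have liftE x y (g : hom (F x) (F y)) : fmap F (lift _ _ g) = g.
  exact: svalP (cid (full x y g)).
pose m b b' (f : hom b b') := lift _ _ (comp (e' b') (comp f (e b))).
have mi b : m b b (idm b) = idm (o b).
  by apply: faithful; rewrite liftE fmap_id comp_idl e'e.
have mc b1 b2 b3 (g : hom b2 b3) (f : hom b1 b2) :
    m _ _ (comp g f) = comp (m _ _ g) (m _ _ f).
  apply: faithful; rewrite fmap_comp !liftE.
  by rewrite -!comp_assoc (comp_assoc (e b2)) ee' comp_idl.
exists (@Functor B A o m mi mc); split; last first.
  by exists e; split=> // x y f; rewrite /= liftE comp_assoc ee' comp_idl.
exists (fun x => lift _ _ (e (F x))); split=> [x|x y f].
  exists (lift _ _ (e' (F x))).
  by split; apply: faithful; rewrite fmap_comp !liftE fmap_id ?e'e ?ee'.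
apply: faithful; rewrite !fmap_comp !liftE.
by rewrite (comp_assoc (e (F y))) ee' comp_idl.
Qed.
End Categories.

(** * The duality D on finite-dimensional modules *)

Section Duality.
Variables (k : fieldType) (C : fincat).

Lemma mor_bij_iso (V W : cmodule k C) (f : mor V W) :
  mor_inj f -> mor_surj f -> is_iso (A := Cmod k C) f.
Proof.
move=> fi fs; have [|g gE] := @factor_inj _ _ _ _ _ f (mor_id W) fi.
  exact: fs.
exists g; split; apply: mor_ext => i x; last exact: gE.
by apply: (fi i); exact: gE.
Qed.

Lemma dual_map_iso (M N : cmodule k (opcat C)) (f : mor N M) :
  is_iso (A := Cmod k (opcat C)) f -> is_iso (A := Cmod k C) (dual_map f).
Proof.
move=> [g [gf fg]]; exists (dual_map g).
split; apply: mor_ext => i p; apply: lin_ext => x; apply: (congr1 p).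
  exact: (congr1 (fun h : mor M M => h i x) fg).
exact: (congr1 (fun h : mor N N => h i x) gf).
Qed.

Lemma dual_map_inj (M N : cmodule k (opcat C)) (f g : mor N M) :
  fin_dim M -> dual_map f = dual_map g -> f = g.
Proof.
move=> fdM fg; apply: mor_ext => i x; apply/eqP; rewrite -subr_eq0; apply/eqP.
apply: fin_dim_separated fdM _ => p; rewrite linearB.
have := congr1 (fun h : mor (dual M) (dual N) => (h i p : dual_space _) x) fg.
by rewrite /= => ->; rewrite subrr.
Qed.

(** For fixed [y], [p |-> phi p y] lies in the bidual and is evaluation at a point [f y];
    functionals separate points, so [f] is linear and natural. *)
Lemma dual_map_full (M N : cmodule k (opcat C)) (phi : mor (dual M) (dual N)) :
  fin_dim M -> exists f : mor N M, dual_map f = phi.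
Proof.
move=> fdM.
have evl (i : C) (y : N i) : linear (fun p : dual_space (M i) => phi i p y : k^o).
  by move=> a p q; rewrite linearP.
have fP (i : C) (y : N i) :
    exists x : M i, forall p : dual_space (M i), phi i p y = p x.
  exact: (fin_dim_reflexive (V := M) (mklin (evl i y)) fdM).
pose f i y := sval (cid (fP i y)).
have fE i y (p : dual_space (M i)) : p (f i y) = phi i p y.
  by rewrite -(svalP (cid (fP i y))).
have sep (i : C) (x y : M i) : (forall p : dual_space (M i), p x = p y) -> x = y.
  move=> e; apply/eqP; rewrite -subr_eq0; apply/eqP.
  by apply: (fin_dim_separated fdM) => p; rewrite linearB e subrr.
have fl i : linear (f i).
  by move=> a x y; apply: sep => p; rewrite linearP !fE linearP.
have fn (i j : opcat C) (q : fhom i j) y :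
    mklin (fl j) (act N q y) = act M q (mklin (fl i) y).
  apply: sep => p; rewrite /= fE.
  have := mor_nat phi (i := j) (j := i) q p.
  move=> /(congr1 (fun p : dual_space _ => p y)) /= <-.
  exact: esym (fE i y ((p \o act M q : {linear M i -> k^o}) : dual_space _)).
exists (@Mor k (opcat C) N M (fun i => mklin (fl i)) fn).
by apply: mor_ext => i p; apply: lin_ext => y; exact: fE.
Qed.

(** [opcat (opcat C)] has the objects and morphisms of [C] but is a different term; repackaging lets
    [dual] apply to a left module. *)
Definition op_op (W : cmodule k C) : cmodule k (opcat (opcat C)) :=
  @CModule k (opcat (opcat C)) W (@act k C W) (@act_id k C W) (@act_comp k C W).

Lemma bidual_iso (W : cmodule k C) : fin_dim W ->
  exists ev : mor W (dual (C := C) (dual (C := opcat C) (op_op W))),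
    is_iso (A := Cmod k C) ev.
Proof.
move=> fdW; pose WD := dual (C := C) (dual (C := opcat C) (op_op W)).
have evl (i : C) (x : W i) : linear (fun p : dual_space (W i) => p x : k^o) by [].
pose ev (i : C) (x : W i) : WD i := mklin (evl i x).
have evL i : linear (ev i) by move=> a x y; apply: lin_ext => p; exact: linearP.
have evn (i j : C) (f : fhom i j) (x : W i) :
    mklin (evL j) (act W f x) = act WD f (mklin (evL i) x).
  by apply: lin_ext.
pose g : mor W WD := @Mor k C W WD (fun i => mklin (evL i)) evn.
exists g; apply: mor_bij_iso => i.
  move=> x y e; apply/eqP; rewrite -subr_eq0; apply/eqP.
  apply: (fin_dim_separated fdW) => p; rewrite linearB.
  have := congr1 (fun q : dual_space (dual_space (W i)) => q p) e.
  by rewrite /= => ->; rewrite subrr.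
move=> phi; have [x xE] := fin_dim_reflexive (V := W) phi fdW.
by exists x; apply: lin_ext => p; rewrite xE.
Qed.
End Duality.

(** * The induced functor and its equivalence *)

Section Nubar.
Variables (k : fieldType) (C : fincat).
Hypotheses (hin : inwards_finite C) (hnoeth : locally_noetherian k C).
Hypothesis hinj : locally_self_injective k C.
Implicit Types X Y Z : fgmod k C.

Let hS : serre (ker_nu (k := k) hin) := ker_nu_serre hin hinj.
Let Q := serre_quotient hnoeth hS.

Definition serre_transpose X Y (u : serre_hom hnoeth hS X Y) :
    mor (homA (sval Y)) (homA (sval X)) :=
  sval (cid (transports_exists hinj (frac_repr u))).

(** The map chosen for the representative is also transported by [F], by [transports_eq]; uniqueness
    makes it [psi]. *)
Lemma serre_transposeE X Y (F : frac hnoeth (ker_nu hin) X Y) psi :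
  transports (graph F) psi -> serre_transpose (frac_class hS F) = psi.
Proof.
apply: (transports_uniq (F := F)); apply: (transports_eq hinj).
  exact: frac_class_repr.
exact: svalP (cid (transports_exists hinj (frac_repr (frac_class hS F)))).
Qed.

Lemma serre_transposeP X Y (F : frac hnoeth (ker_nu hin) X Y) :
  transports (graph F) (serre_transpose (frac_class hS F)).
Proof.
by have [psi H] := transports_exists hinj F; rewrite (serre_transposeE H).
Qed.

Lemma serre_transpose_of X Y (f : mor (sval X) (sval Y)) :
  serre_transpose (frac_class hS (frac_of hnoeth hS f)) = homA_map f.
Proof. by apply: serre_transposeE => i h j x y /= ->. Qed.

Lemma serre_transpose_inj X Y (u v : serre_hom hnoeth hS X Y) :
  serre_transpose u = serre_transpose v -> u = v.
Proof.
rewrite -(frac_reprK u) -(frac_reprK v) => e; apply/frac_classE.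
have := serre_transposeP (F := frac_repr u); rewrite e => H.
by apply: (transports_frac_eq hinj H); exact: serre_transposeP.
Qed.

Lemma serre_transpose_full X Y (psi : mor (homA (sval Y)) (homA (sval X))) :
  exists u : serre_hom hnoeth hS X Y, serre_transpose u = psi.
Proof.
exists (frac_class hS (transport_frac hin hnoeth hinj psi)).
by apply: serre_transposeE; exact: transport_fracP.
Qed.

Definition nubar_map X Y (u : serre_hom hnoeth hS X Y) :
    Defs.hom (nu_ob hin X) (nu_ob hin Y) := dual_map (serre_transpose u).

Lemma nubar_map_of X Y (f : mor (sval X) (sval Y)) :
  nubar_map (frac_class hS (frac_of hnoeth hS f)) = nu_map hin (f : Defs.hom X Y).
Proof. by rewrite /nubar_map serre_transpose_of. Qed.

Lemma nubar_map_id X : nubar_map (idm (X : Q)) = idm (nu_ob hin X).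
Proof. by rewrite [LHS]nubar_map_of -nu_map_id. Qed.

Lemma nubar_map_comp X Y Z (v : serre_hom hnoeth hS Y Z)
    (u : serre_hom hnoeth hS X Y) :
  nubar_map (serre_comp v u) = comp (nubar_map v) (nubar_map u).
Proof.
rewrite /nubar_map -(frac_reprK u) -(frac_reprK v) serre_compE.
set F := frac_repr u; set G := frac_repr v.
rewrite (@serre_transposeE _ _ _ (mor_comp (serre_transpose (frac_class hS F))
  (serre_transpose (frac_class hS G)))).
  by apply: mor_ext => i p; apply: lin_ext.
move=> i h j x z [y [/= Fxy Gyz]].
exact: etrans (serre_transposeP _ Fxy) (serre_transposeP _ Gyz).
Qed.

Definition nubar : functor Q (fdmod k C) :=
  @Functor Q (fdmod k C) (nu_ob hin) nubar_map nubar_map_id nubar_map_comp.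

Lemma nubar_quotient : functor_comp nubar (quotient_functor hnoeth hS) = nu k hin.
Proof. by apply: functor_ext => X Y f; exact: nubar_map_of. Qed.

Lemma fin_dim_homA X : fin_dim (homA (sval X)).
Proof. exact: homA_fin_dim hin (svalP X). Qed.

Lemma nubar_equivalence : is_equivalence nubar.
Proof.
apply: fully_faithful_equivalence.
- move=> X Y phi; have [psi <-] := dual_map_full phi (fin_dim_homA X).
  by have [u <-] := serre_transpose_full psi; exists u.
- move=> X Y u v /(dual_map_inj (fin_dim_homA X)); exact: serre_transpose_inj.
(* With [V] such that Hom(V, A) is isomorphic to D W, applying D gives an isomorphism from nu V to D
   D W, hence to W. *)
move=> W; pose W0 : cmodule k C := sval (sval W).
have fdW : fin_dim W0 := svalP W.
have fdM := @dual_fin_dim k (opcat C) (op_op W0) fdW.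
have [V [f [fi fs]]] := homA_ess_surj hin hnoeth hinj fdM.
have [ev [d [d_ev ev_d]]] := bidual_iso fdW.
exists V, (comp (c := Cmod k C) d (dual_map f)).
apply: (is_iso_comp (A := Cmod k C)); first by exists ev.
exact/dual_map_iso/mor_bij_iso.
Qed.
End Nubar.

Theorem theorem3p6 (k : fieldType) (C : fincat)
    (hEI : EI C) (hskel : skeletal C) (hin : inwards_finite C)
    (hnoeth : locally_noetherian k C)
    (hchar : [pchar k] =i pred0)
    (hinj : locally_self_injective k C) :
  let Q := quotient_functor hnoeth (ker_nu_serre hin hinj) in
  exists nubar :
      functor (serre_quotient hnoeth (ker_nu_serre hin hinj)) (fdmod k C),
    functor_comp nubar Q = nu k hin /\ is_equivalence nubar.
Proof.
exists (nubar hin hnoeth hinj).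
by split; [exact: nubar_quotient | exact: nubar_equivalence].
Qed.
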